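(* Let $(X,\mu)$ be a $\sigma$-finite measure space and let $h:X\to\mathbb{R}^{d+1}$ be measurable. Then the $S$-spectrum of the multiplication operator $M_h$ on $L^2(X)$ is $$\sigma_S(M_h)=[\operatorname{essran}(h)],\qquad\text{where }[\operatorname{essran}(h)]=\big\{s\in\mathbb{R}^{d+1}\;\big|\;[s]\cap\operatorname{essran}(h)\neq\emptyset\big\}.$$ Moreover, for every $s\in\rho_S(M_h)$, the left and right $S$-resolvent operators act as the multiplication operators $$S_L^{-1}(s,M_h)=M_{S_L^{-1}(s,h(\cdot))}\qquad\text{and}\qquad S_R^{-1}(s,M_h)=M_{S_R^{-1}(s,h(\cdot))}.$$
   Context: Clifford algebra: for $d\in\mathbb{N}$, $d\ge1$, $\mathbb{R}_d$ is the real Clifford algebra generated by $e_1,\dots,e_d$ with $e_i^2=-1$, $e_ie_j=-e_je_i$ for $i\neq j$, with real basis $e_A=e_{i_1}\cdots e_{i_r}$, $A=(i_1,\dots,i_r)$, $1\le i_1<\dots<i_r\le d$, $e_\emptyset=1$; for $s=\sum_As_Ae_A$, $\overline{s}=\sum_A(-1)^{|A|(|A|+1)/2}s_Ae_A$, $|s|^2=\sum_As_A^2$. Paravectors: $\mathbb{R}^{d+1}=\{s_0+s_1e_1+\dots+s_de_d\}$, $\operatorname{Im}(s)=s_1e_1+\dots+s_de_d$; $\mathbb{S}=\{J\in\mathbb{R}^{d+1}\mid J_0=0,|J|=1\}$; $[s]=\{s_0+J|\operatorname{Im}(s)|\mid J\in\mathbb{S}\}$. Hilbert module: $V=L^2(X)$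 is the space of (classes of) measurable $f:X\to\mathbb{R}_d$ with $\int_X|f|^2d\mu<\infty$, with pointwise left and right multiplication by Clifford numbers. $\mathcal{B}(V)$: bounded everywhere defined right-linear operators on $V$. Clifford numbers act on operators by left multiplication: $(sT)v=s(Tv)$, $(Ts)v=T(sv)$. Multiplication operator: for measurable $g:X\to\mathbb{R}_d$ (defined almost everywhere), $(M_gf)(x)=g(x)f(x)$ with $\operatorname{dom}(M_g)=\{f\in L^2(X)\mid gf\in L^2(X)\}$; it is a closed, densely defined right-linear operator. $S$-spectrum: for a closed right-linear operator $T$ and $s\in\mathbb{R}^{d+1}$, $Q_s[T]=T^2-2s_0T+|s|^2$ on $\operatorname{dom}(T^2)$, $\rho_S(T)=\{s\in\mathbb{R}^{d+1}\mid Q_s[T]^{-1}\in\mathcal{B}(V)\}$, $\sigma_S(T)=\mathbb{R}^{d+1}\setminus\rho_S(T)$; for $s\in\rho_S(T)$, $S_L^{-1}(s,T)=Q_s[T]^{-1}\overline{s}-TQ_s[T]^{-1}$, $S_R^{-1}(s,T)=(\overline{s}-T)Q_s[T]^{-1}$. For paravectors $q\notin[s]$: $S_L^{-1}(s,q)=(q^2-2s_0q+|s|^2)^{-1}\overline{s}-q(q^2-2s_0q+|s|^2)^{-1}$, $S_R^{-1}(s,q)=(\overline{s}-q)(q^2-2s_0q+|s|^2)^{-1}$. Essential range: $\operatorname{essran}(h)=\{s\in\mathbb{R}^{d+1}\mid\forall\varepsilon>0:\mu\{x\in X\mid|h(x)-s|<\varepsilon\}>0\}$. *)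

(* Defs.v *)
From HB Require Import structures.
From mathcomp Require Import all_boot all_order all_algebra.
From mathcomp Require Import all_classical all_reals all_analysis measurable_realfun.
From mathcomp Require Import ring lra.
Set Implicit Arguments.
Unset Strict Implicit.
Unset Printing Implicit Defensive.
Import Order.TTheory GRing.Theory Num.Theory.
Import numFieldNormedType.Exports.
Local Open Scope classical_set_scope.
Local Open Scope ring_scope.

Definition symdiff (T : finType) (A B : {set T}) : {set T} :=
  [set i | (i \in A) (+) (i \in B)].

(* The element with coefficients (x_A) in the basis e_A; the generators
   e_1, ..., e_d are indexed by 'I_d. *)
Definition clifford (R : realType) (d : nat) : Type := {ffun {set 'I_d} -> R}.

Section CliffordAlgebra.
Context {R : realType} {d : nat}.
Local Notation Cl := (clifford R d).
Implicit Types (A B C : {set 'I_d}) (x y z : Cl).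

HB.instance Definition _ := GRing.Lmodule.on Cl.

Definition cl_base A : Cl := [ffun B => (A == B)%:R].

(* e_A e_B = cl_sign A B e_(A symdiff B): sorting the concatenation of A and B
   costs a factor -1 for every i in A and j in B with j < i, and every common
   index then contributes e_i^2 = -1. *)
Definition cl_sign A B : R :=
  \prod_(i in A) \prod_(j in B | (j <= i)%N) -1.

Definition cl_mul x y : Cl :=
  \sum_A \sum_B (cl_sign A B * (x A * y B)) *: cl_base (symdiff A B).

Definition cl_one : Cl := cl_base finset.set0.

Lemma cl_expand x : x = \sum_A x A *: cl_base A.
Proof.
apply/ffunP => B; rewrite sum_ffunE (bigD1 B) //= !ffunE eqxx.
rewrite /GRing.scale /= mulr1 big1 ?addr0 // => A /negPf nAB.
by rewrite !ffunE nAB /GRing.scale /= mulr0.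
Qed.

Lemma symdiffA A B C : symdiff A (symdiff B C) = symdiff (symdiff A B) C.
Proof. by apply/setP => i; rewrite !inE addbA. Qed.
Lemma symdiff0s A : symdiff finset.set0 A = A.
Proof. by apply/setP => i; rewrite !inE. Qed.
Lemma symdiffs0 A : symdiff A finset.set0 = A.
Proof. by apply/setP => i; rewrite !inE addbF. Qed.
Lemma symdiffss A : symdiff A A = finset.set0.
Proof. by apply/setP => i; rewrite !inE addbb. Qed.

Local Lemma prod_symdiff (f : 'I_d -> R) A B : (forall i, f i * f i = 1) ->
  \prod_(i in symdiff A B) f i = \prod_(i in A) f i * \prod_(i in B) f i.
Proof.
move=> f1; rewrite big_mkcond [X in _ = X * _]big_mkcond.
rewrite [X in _ = _ * X]big_mkcond -big_split /=; apply: eq_bigr => i _.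
by rewrite inE; case: (i \in A); case: (i \in B); rewrite /= ?mulr1 ?mul1r ?f1.
Qed.

Local Lemma cl_signE A B :
  cl_sign A B = \prod_(i in A) \prod_(j in B) (if (j <= i)%N then -1 else 1).
Proof. by apply: eq_bigr => i _; rewrite big_mkcondr. Qed.

Local Lemma cl_sign_exch A B :
  cl_sign A B = \prod_(j in B) \prod_(i in A) (if (j <= i)%N then -1 else 1).
Proof. by rewrite cl_signE exchange_big. Qed.

Local Lemma sq1 (i j : 'I_d) :
  (if (j <= i)%N then -1 else 1) * (if (j <= i)%N then -1 else 1) = 1 :> R.
Proof. by case: ifP; rewrite ?mulrNN mulr1. Qed.

Lemma cl_sign_symdiffl A B C :
  cl_sign (symdiff A B) C = cl_sign A C * cl_sign B C.
Proof.
rewrite !cl_signE prod_symdiff // => i.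
by rewrite -big_split /= big1 // => j _; exact: sq1.
Qed.

Lemma cl_sign_symdiffr A B C :
  cl_sign A (symdiff B C) = cl_sign A B * cl_sign A C.
Proof.
rewrite !cl_sign_exch prod_symdiff // => i.
by rewrite -big_split /= big1 // => j _; exact: sq1.
Qed.

Lemma cl_sign0s A : cl_sign finset.set0 A = 1.
Proof. by rewrite /cl_sign big_set0. Qed.
Lemma cl_signs0 A : cl_sign A finset.set0 = 1.
Proof. by rewrite cl_sign_exch big_set0. Qed.

Lemma cl_mulE x y C :
  cl_mul x y C = \sum_A cl_sign A (symdiff A C) * (x A * y (symdiff A C)).
Proof.
rewrite /cl_mul sum_ffunE; apply: eq_bigr => A _; rewrite sum_ffunE.
rewrite (bigD1 (symdiff A C)) //= !ffunE symdiffA symdiffss symdiff0s eqxx.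
rewrite /GRing.scale /= mulr1 big1 ?addr0 // => B nB; rewrite !ffunE.
case: eqP => [E|_]; last by rewrite /GRing.scale /= mulr0.
by move: nB; rewrite -E symdiffA symdiffss symdiff0s eqxx.
Qed.

Lemma cl_mul1l : left_id cl_one cl_mul.
Proof.
move=> x; apply/ffunP => C; rewrite cl_mulE (bigD1 finset.set0) //=.
rewrite cl_sign0s ffunE eqxx !mul1r symdiff0s big1 ?addr0 // => A nA.
by rewrite ffunE eq_sym (negPf nA) mul0r mulr0.
Qed.

Lemma cl_mul1r : right_id cl_one cl_mul.
Proof.
move=> x; apply/ffunP => C; rewrite cl_mulE (bigD1 C) //=.
rewrite symdiffss cl_signs0 ffunE eqxx mul1r mulr1 big1 ?addr0 // => A nA.
rewrite ffunE; case: eqP => [E|_]; last by rewrite !mulr0.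
by move: nA; rewrite -[C]symdiff0s -(symdiffss A) -symdiffA -E symdiffs0 eqxx.
Qed.

Lemma cl_mulDl : left_distributive cl_mul +%R.
Proof.
move=> x y z; apply/ffunP => C; rewrite ffunE !cl_mulE -big_split /=.
by apply: eq_bigr => A _; rewrite ffunE mulrDl mulrDr.
Qed.

Lemma cl_mulDr : right_distributive cl_mul +%R.
Proof.
move=> x y z; apply/ffunP => C; rewrite ffunE !cl_mulE -big_split /=.
by apply: eq_bigr => A _; rewrite ffunE !mulrDr.
Qed.

Lemma cl_mulA : associative cl_mul.
Proof.
move=> x y z; apply/ffunP => C; rewrite !cl_mulE.
under eq_bigr do rewrite cl_mulE 2!big_distrr /=.
under [RHS]eq_bigr do rewrite cl_mulE big_distrl big_distrr /=.
rewrite [RHS]exchange_big /=; apply: eq_bigr => A _.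
rewrite [RHS](reindex_inj (h := symdiff A)) /=; last first.
  by move=> B D /(congr1 (symdiff A)); rewrite !symdiffA symdiffss !symdiff0s.
apply: eq_bigr => B _; rewrite [symdiff A (symdiff A B)]symdiffA symdiffss.
rewrite symdiff0s -[symdiff (symdiff A B) C]symdiffA.
have -> : symdiff B (symdiff A C) = symdiff A (symdiff B C).
  by apply/setP => i; rewrite !inE !addbA [(i \in B) (+) _]addbC.
set D := symdiff A (symdiff B C).
have EC : symdiff A C = symdiff B D.
  by apply/setP => i; rewrite !inE; do 3 case: (i \in _).
rewrite EC cl_sign_symdiffl cl_sign_symdiffr.
by ring.
Qed.

Lemma cl_one_neq0 : cl_one != 0.
Proof.
by apply/eqP => /ffunP /(_ finset.set0) /eqP; rewrite !ffunE eqxx oner_eq0.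
Qed.

HB.instance Definition _ := GRing.Zmodule_isNzRing.Build Cl
  cl_mulA cl_mul1l cl_mul1r cl_mulDl cl_mulDr cl_one_neq0.

Lemma cl_coefM x y C :
  (x * y) C = \sum_A cl_sign A (symdiff A C) * (x A * y (symdiff A C)).
Proof. exact: cl_mulE. Qed.

Lemma cl_scaleAl (a : R) x y : a *: (x * y) = (a *: x) * y.
Proof.
apply/ffunP => C; rewrite ffunE !cl_mulE /GRing.scale /= big_distrr /=.
by apply: eq_bigr => A _; rewrite ffunE /GRing.scale /=; ring.
Qed.
Lemma cl_scaleAr (a : R) x y : a *: (x * y) = x * (a *: y).
Proof.
apply/ffunP => C; rewrite ffunE !cl_mulE /GRing.scale /= big_distrr /=.
by apply: eq_bigr => A _; rewrite ffunE /GRing.scale /=; ring.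
Qed.
HB.instance Definition _ := GRing.Lmodule_isLalgebra.Build R Cl cl_scaleAl.
HB.instance Definition _ := GRing.Lalgebra_isAlgebra.Build R Cl cl_scaleAr.

Definition cl_unit : {pred Cl} :=
  fun x => `[< exists y, y * x = 1 /\ x * y = 1 >].
Definition cl_inv x : Cl :=
  if x \in cl_unit then xget 0 [set y | y * x = 1 /\ x * y = 1] else x.

Local Lemma cl_invP x : x \in cl_unit -> cl_inv x * x = 1 /\ x * cl_inv x = 1.
Proof. by move=> ux; rewrite /cl_inv ux; move/asboolP: ux => /xgetPex. Qed.
Local Lemma cl_mulVr : {in cl_unit, left_inverse 1 cl_inv *%R}.
Proof. by move=> x /cl_invP[]. Qed.
Local Lemma cl_mulrV : {in cl_unit, right_inverse 1 cl_inv *%R}.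
Proof. by move=> x /cl_invP[]. Qed.
Local Lemma cl_unitP x y : y * x = 1 /\ x * y = 1 -> x \in cl_unit.
Proof. by move=> yx; apply/asboolP; exists y. Qed.
Local Lemma cl_inv_out : {in [predC cl_unit], cl_inv =1 id}.
Proof. by move=> x; rewrite inE /cl_inv => /negPf ->. Qed.

HB.instance Definition _ := GRing.NzRing_hasMulInverse.Build Cl
  cl_mulVr cl_mulrV cl_unitP cl_inv_out.

Definition cl_gen (i : 'I_d) : Cl := cl_base [set i].

Lemma cl_baseM A B : cl_base A * cl_base B = cl_sign A B *: cl_base (symdiff A B).
Proof.
apply/ffunP => C; rewrite [LHS]cl_mulE (bigD1 A) //= !ffunE eqxx mul1r.
rewrite big1 => [|D /negPf nD]; last by rewrite ffunE eq_sym nD mul0r mulr0.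
rewrite addr0 /GRing.scale /=.
have -> : (B == symdiff A C) = (symdiff A B == C).
  apply/eqP/eqP => [->|<-]; by rewrite symdiffA symdiffss symdiff0s.
case: eqP => [<-|_]; last by rewrite !mulr0.
by rewrite symdiffA symdiffss symdiff0s.
Qed.

Lemma cl_gen_sqr i : cl_gen i * cl_gen i = -1.
Proof.
rewrite cl_baseM symdiffss cl_signE !big_set1 leqnn scaleN1r //.
Qed.

Lemma cl_genC i j : i != j -> cl_gen i * cl_gen j = - (cl_gen j * cl_gen i).
Proof.
move=> nij; rewrite !cl_baseM !cl_signE !big_set1.
have -> : symdiff [set j] [set i] = symdiff [set i] [set j].
  by apply/setP => k; rewrite !inE addbC.
rewrite -scaleNr; congr (_ *: _); case: (ltngtP i j) => [||/val_inj E].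
- by rewrite opprK.
- by [].
- by rewrite E eqxx in nij.
Qed.

Lemma cl_baseE A : cl_base A = \prod_(i in A) cl_gen i.
Proof.
suff H (s : seq 'I_d) : sorted ltn (map val s) ->
    \prod_(i <- s) cl_gen i = cl_base [set i in s].
  rewrite -big_filter [index_enum _]unlock -enumT H.
    by congr cl_base; apply/setP => i; rewrite inE mem_filter mem_enum andbT.
  apply: (subseq_sorted ltn_trans _ (iota_ltn_sorted 0 d)).
  rewrite -val_enum_ord; apply: map_subseq.
  exact: filter_subseq.
elim: s => [_|i s IHs /= si].
  by rewrite big_nil; congr cl_base; apply/setP => i; rewrite !inE.
rewrite big_cons IHs ?(path_sorted si) // cl_baseM cl_signE big_set1.
have lt_i j : j \in s -> (i < j)%N.
  move=> js; have /allP := order_path_min ltn_trans si.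
  by apply; apply: map_f.
rewrite big1 ?scale1r => [|j]; last by rewrite inE => /lt_i; case: leqP.
congr cl_base; apply/setP => j; rewrite !inE.
by case: eqP => // ->; case: (boolP (i \in s)) => // /lt_i; rewrite ltnn.
Qed.

Definition cl_conj x : Cl := [ffun A : {set _} => (-1) ^+ (#|A| * #|A|.+1)./2 * x A].
Definition cl_norm x : R := Num.sqrt (\sum_A x A ^+ 2).

Definition cl_re x : R := x finset.set0.
Definition cl_im x : Cl := \sum_(i < d) x [set i]%SET *: cl_gen i.

Definition paravector : set Cl := [set s | s = (cl_re s)%:A + cl_im s].

Definition im_unit_sphere : set Cl :=
  [set J | [/\ paravector J, cl_re J = 0 & cl_norm J = 1]].

Definition cl_sphere (s : Cl) : set Cl :=
  [set (cl_re s)%:A + cl_norm (cl_im s) *: J | J in im_unit_sphere].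

(* [A] = {s in R^(d+1) | [s] meets A} *)
Definition axial_hull (A : set Cl) : set Cl :=
  [set s | paravector s /\ cl_sphere s `&` A !=set0].

Definition Qpoly (s q : Cl) : Cl :=
  q ^+ 2 - (2 * cl_re s) *: q + (cl_norm s ^+ 2)%:A.
(* For paravectors q in [s] one has Qpoly s q = 0; the value there is junk. *)
Definition SL_kernel (s q : Cl) : Cl :=
  (Qpoly s q)^-1 * cl_conj s - q * (Qpoly s q)^-1.
Definition SR_kernel (s q : Cl) : Cl := (cl_conj s - q) * (Qpoly s q)^-1.

Lemma cl_norm_ge0 x : 0 <= cl_norm x.
Proof. exact: sqrtr_ge0. Qed.
Lemma cl_norm_sqr x : cl_norm x ^+ 2 = \sum_A x A ^+ 2.
Proof. by rewrite sqr_sqrtr // sumr_ge0 // => A _; rewrite sqr_ge0. Qed.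
Lemma cl_coef_le x A : `|x A| <= cl_norm x.
Proof.
rewrite -(sqrtr_sqr (x A)) ler_wsqrtr // (bigD1 A) //= lerDl.
by rewrite sumr_ge0 // => B _; rewrite sqr_ge0.
Qed.
Lemma cl_normN x : cl_norm (- x) = cl_norm x.
Proof. by congr Num.sqrt; apply: eq_bigr => A _; rewrite ffunE sqrrN. Qed.
Lemma cl_normD_sqr x y :
  cl_norm (x + y) ^+ 2 <= 2 * (cl_norm x ^+ 2 + cl_norm y ^+ 2).
Proof.
rewrite !cl_norm_sqr -big_split /= mulr_sumr; apply: ler_sum => A _.
rewrite ffunE -subr_ge0 (_ : _ - _ = (x A - y A) ^+ 2) ?sqr_ge0 //.
by rewrite sqrrD sqrrB mulr2n !mulrDl !mul1r; ring.
Qed.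
Lemma cl_normM_sqr x y :
  cl_norm (x * y) ^+ 2 <= (#|{set 'I_d}| ^ 3)%:R * cl_norm x ^+ 2 * cl_norm y ^+ 2.
Proof.
rewrite -mulrA -exprMn [X in X <= _]cl_norm_sqr.
set N := #|_|; set M := cl_norm x * cl_norm y.
have le_C C : (x * y) C ^+ 2 <= (N%:R * M) ^+ 2.
  rewrite -real_normK ?num_real // lerXn2r ?nnegrE ?mulr_ge0 ?cl_norm_ge0 //.
  rewrite cl_coefM (le_trans (ler_norm_sum _ _ _)) //.
  rewrite (_ : N%:R * M = \sum_(A : {set 'I_d}) M); last first.
    by rewrite sumr_const mulr_natl.
  apply: ler_sum => A _; rewrite !normrM.
  have -> : `|cl_sign A (symdiff A C)| = 1.
    rewrite cl_signE normr_prod big1 // => i _.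
    by rewrite normr_prod big1 // => j _; case: ifP; rewrite ?normrN normr1.
  by rewrite mul1r ler_pM // cl_coef_le.
rewrite (le_trans (ler_sum _ (fun C _ => le_C C))) // sumr_const -/N.
by rewrite -[X in X <= _]mulr_natl exprMn mulrA -exprS natrX.
Qed.

End CliffordAlgebra.

Section HilbertModule.
Context {disp : measure_display} {X : measurableType disp} {R : realType}.
Context (mu : {measure set X -> \bar R}) (d : nat).
Local Notation Cl := (clifford R d).

Definition cl_measurable (f : X -> Cl) :=
  forall A, measurable_fun setT (fun x => f x A).

Definition square_integrable (f : X -> Cl) :=
  cl_measurable f /\ (\int[mu]_x (cl_norm (f x) ^+ 2)%:E < +oo)%E.

Lemma cl_measurableD f g : cl_measurable f -> cl_measurable g ->
  cl_measurable (fun x => f x + g x).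
Proof.
move=> mf mg A; under eq_fun do rewrite ffunE; exact: measurable_funD.
Qed.
Lemma cl_measurableN f : cl_measurable f -> cl_measurable (fun x => - f x).
Proof. by move=> mf A; under eq_fun do rewrite ffunE; exact: measurable_funN. Qed.
Lemma cl_measurable_cst a : cl_measurable (fun=> a).
Proof. by move=> A; exact: measurable_cst. Qed.
Lemma cl_measurableM f g : cl_measurable f -> cl_measurable g ->
  cl_measurable (fun x => f x * g x).
Proof.
move=> mf mg A; under eq_fun do rewrite cl_coefM.
apply: measurable_sum => B; apply: measurable_funM; first exact: measurable_cst.
by apply: measurable_funM.
Qed.
Lemma cl_measurable_norm_sqr f : cl_measurable f ->
  measurable_fun setT (fun x => cl_norm (f x) ^+ 2).
Proof.
move=> mf; under eq_fun do rewrite cl_norm_sqr.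
by apply: measurable_sum => A; apply: measurable_funX.
Qed.

Local Lemma sqint_le f (K : R) (F : X -> R) : cl_measurable f -> measurable_fun setT F ->
  0 <= K -> (forall x, 0 <= F x) -> (forall x, cl_norm (f x) ^+ 2 <= K * F x) ->
  (\int[mu]_x (F x)%:E < +oo)%E -> square_integrable f.
Proof.
move=> mf mF K0 F0 fF iF; split=> //.
apply: (@le_lt_trans _ _ (K%:E * \int[mu]_x (F x)%:E)%E); last first.
  by rewrite lte_mul_pinfty.
rewrite -ge0_integralZl_EFin //; first last.
- exact/measurable_EFinP.
- by move=> x _; rewrite lee_fin.
apply: ge0_le_integral => //.
- by move=> x _; rewrite lee_fin exprn_ge0 ?cl_norm_ge0.
- by apply/measurable_EFinP; exact: cl_measurable_norm_sqr.
- by apply/measurable_EFinP; apply: measurable_funM.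
- by move=> x _; rewrite -EFinM lee_fin.
Qed.

Lemma square_integrable0 : square_integrable (fun=> 0).
Proof.
split; first exact: cl_measurable_cst.
have -> : cl_norm (0 : Cl) ^+ 2 = 0.
  by rewrite cl_norm_sqr big1 // => A _; rewrite ffunE expr0n.
by rewrite integral0.
Qed.
Lemma square_integrableD f g : square_integrable f -> square_integrable g ->
  square_integrable (fun x => f x + g x).
Proof.
move=> [mf sf] [mg sg].
apply: (@sqint_le _ 2 (fun x => cl_norm (f x) ^+ 2 + cl_norm (g x) ^+ 2)) => //.
- exact: cl_measurableD.
- by apply: measurable_funD; exact: cl_measurable_norm_sqr.
- by move=> x; rewrite addr_ge0 ?exprn_ge0 ?cl_norm_ge0.
- by move=> x; exact: cl_normD_sqr.
- under eq_integral do rewrite EFinD.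
  rewrite ge0_integralD //; first by rewrite lte_add_pinfty.
  + by move=> x _; rewrite lee_fin exprn_ge0 ?cl_norm_ge0.
  + by apply/measurable_EFinP; exact: cl_measurable_norm_sqr.
  + by move=> x _; rewrite lee_fin exprn_ge0 ?cl_norm_ge0.
  + by apply/measurable_EFinP; exact: cl_measurable_norm_sqr.
Qed.
Lemma square_integrableN f : square_integrable f ->
  square_integrable (fun x => - f x).
Proof.
move=> [mf sf]; split; first exact: cl_measurableN.
by under eq_integral do rewrite cl_normN.
Qed.
Lemma square_integrable_lmul a f : square_integrable f ->
  square_integrable (fun x => a * f x).
Proof.
move=> [mf sf].
apply: (@sqint_le _ ((#|{set 'I_d}| ^ 3)%:R * cl_norm a ^+ 2)
  (fun x => cl_norm (f x) ^+ 2)) => //.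
- by apply: cl_measurableM => //; exact: cl_measurable_cst.
- exact: cl_measurable_norm_sqr.
- by rewrite mulr_ge0 ?exprn_ge0 ?cl_norm_ge0.
- by move=> x; rewrite exprn_ge0 ?cl_norm_ge0.
- by move=> x; exact: cl_normM_sqr.
Qed.
Lemma square_integrable_rmul a f : square_integrable f ->
  square_integrable (fun x => f x * a).
Proof.
move=> [mf sf].
apply: (@sqint_le _ ((#|{set 'I_d}| ^ 3)%:R * cl_norm a ^+ 2)
  (fun x => cl_norm (f x) ^+ 2)) => //.
- by apply: cl_measurableM => //; exact: cl_measurable_cst.
- exact: cl_measurable_norm_sqr.
- by rewrite mulr_ge0 ?exprn_ge0 ?cl_norm_ge0.
- by move=> x; rewrite exprn_ge0 ?cl_norm_ge0.
- by move=> x; rewrite mulrAC; exact: cl_normM_sqr.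
Qed.

Record L2fun := MkL2fun {
  L2fun_val :> X -> Cl;
  L2funP : square_integrable L2fun_val }.

HB.instance Definition _ := gen_eqMixin L2fun.
HB.instance Definition _ := gen_choiceMixin L2fun.

Definition L2_equiv (f g : L2fun) := `[< {ae mu, forall x, f x = g x} >].

Local Lemma L2_equiv_refl : reflexive L2_equiv.
Proof. by move=> f; apply/asboolP/aeW. Qed.
Local Lemma L2_equiv_sym : symmetric L2_equiv.
Proof. by move=> f g; apply/asboolP/asboolP; apply: filterS => x ->. Qed.
Local Lemma L2_equiv_trans : transitive L2_equiv.
Proof.
by move=> g f h /asboolP fg /asboolP gh; apply/asboolP;
  apply: filterS2 fg gh => x -> ->.
Qed.

Canonical L2_equiv_canonical :=
  EquivRel L2_equiv L2_equiv_refl L2_equiv_sym L2_equiv_trans.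

Local Open Scope quotient_scope.

Definition L2 : Type := {eq_quot L2_equiv}.
HB.instance Definition _ := Choice.on L2.
HB.instance Definition _ := EqQuotient.on L2.

Definition L2_class f (Pf : square_integrable f) : L2 := \pi_L2 (MkL2fun Pf).
Definition L2_repr (u : L2) : X -> Cl := repr u.

Lemma L2_reprP u : square_integrable (L2_repr u).
Proof. exact: L2funP. Qed.
Lemma L2_classK f (Pf : square_integrable f) :
  {ae mu, forall x, L2_repr (L2_class Pf) x = f x}.
Proof.
have /eqmodP /asboolP := reprK (L2_class Pf); exact.
Qed.
Lemma L2_eqP (u v : L2) :
  u = v <-> {ae mu, forall x, L2_repr u x = L2_repr v x}.
Proof.
split=> [->|uv]; first exact: aeW.
by rewrite -[u]reprK -[v]reprK; apply/eqmodP/asboolP.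
Qed.

Definition L2_zero : L2 := L2_class square_integrable0.
Definition L2_add u v : L2 :=
  L2_class (square_integrableD (L2_reprP u) (L2_reprP v)).
Definition L2_opp u : L2 := L2_class (square_integrableN (L2_reprP u)).
Definition L2_lmul (a : Cl) u : L2 :=
  L2_class (square_integrable_lmul a (L2_reprP u)).
Definition L2_rmul u (a : Cl) : L2 :=
  L2_class (square_integrable_rmul a (L2_reprP u)).

Local Lemma L2_addE u v :
  {ae mu, forall x, L2_repr (L2_add u v) x = L2_repr u x + L2_repr v x}.
Proof. exact: L2_classK. Qed.
Local Lemma L2_lmulE a u :
  {ae mu, forall x, L2_repr (L2_lmul a u) x = a * L2_repr u x}.
Proof. exact: L2_classK. Qed.

Local Lemma L2_rmulE u a :
  {ae mu, forall x, L2_repr (L2_rmul u a) x = L2_repr u x * a}.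
Proof. exact: L2_classK. Qed.
Local Lemma L2_oppE u : {ae mu, forall x, L2_repr (L2_opp u) x = - L2_repr u x}.
Proof. exact: L2_classK. Qed.
Local Lemma L2_zeroE : {ae mu, forall x, L2_repr L2_zero x = 0}.
Proof. exact: L2_classK. Qed.

Local Lemma L2_addA : associative L2_add.
Proof.
move=> u v w; apply/L2_eqP; near=> x.
rewrite (near (L2_addE u _)) ?(near (L2_addE v _)) //.
rewrite (near (L2_addE (L2_add u v) _)) ?(near (L2_addE u _)) // ?addrA //.
Unshelve. all: by end_near. Qed.
Local Lemma L2_addC : commutative L2_add.
Proof.
move=> u v; apply/L2_eqP; near=> x.
rewrite (near (L2_addE u _)) ?(near (L2_addE v _)) // addrC //.
Unshelve. all: by end_near. Qed.
Local Lemma L2_add0 : left_id L2_zero L2_add.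
Proof.
move=> u; apply/L2_eqP; near=> x.
rewrite (near (L2_addE _ u)) ?(near L2_zeroE) // add0r //.
Unshelve. all: by end_near. Qed.
Local Lemma L2_addN : left_inverse L2_zero L2_opp L2_add.
Proof.
move=> u; apply/L2_eqP; near=> x.
rewrite (near (L2_addE _ u)) ?(near L2_zeroE) ?(near (L2_oppE u)) // addNr //.
Unshelve. all: by end_near. Qed.

HB.instance Definition _ := GRing.isZmodule.Build L2
  L2_addA L2_addC L2_add0 L2_addN.

Local Lemma L2_lmulA a b u : L2_lmul a (L2_lmul b u) = L2_lmul (a * b) u.
Proof.
apply/L2_eqP; near=> x.
rewrite (near (L2_lmulE a _)) ?(near (L2_lmulE b _)) //.
rewrite (near (L2_lmulE (a * b) _)) // mulrA //.
Unshelve. all: by end_near. Qed.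
Local Lemma L2_lmul1 : left_id 1 L2_lmul.
Proof.
move=> u; apply/L2_eqP; near=> x; rewrite (near (L2_lmulE 1 u)) // mul1r //.
Unshelve. all: by end_near. Qed.
Local Lemma L2_lmulDr : right_distributive L2_lmul +%R.
Proof.
move=> a u v; apply/L2_eqP; near=> x.
rewrite (near (L2_lmulE a (L2_add u v))) ?(near (L2_addE u _)) //.
rewrite (near (L2_addE (L2_lmul a u) _)) ?(near (L2_lmulE a u)) //.
rewrite (near (L2_lmulE a v)) // mulrDr //.
Unshelve. all: by end_near. Qed.
Local Lemma L2_lmulDl u : {morph L2_lmul^~ u : a b / a + b}.
Proof.
move=> a b; apply/L2_eqP; near=> x.
rewrite (near (L2_lmulE (a + b) u)) //.
rewrite (near (L2_addE (L2_lmul a u) _)) ?(near (L2_lmulE a u)) //.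
rewrite (near (L2_lmulE b u)) // mulrDl //.
Unshelve. all: by end_near. Qed.

(* a *: u is the pointwise left multiplication of u by a Clifford number. *)
HB.instance Definition _ := GRing.Zmodule_isLmodule.Build Cl L2
  L2_lmulA L2_lmul1 L2_lmulDr L2_lmulDl.

Lemma L2_reprD u v :
  {ae mu, forall x, L2_repr (u + v) x = L2_repr u x + L2_repr v x}.
Proof. exact: L2_addE. Qed.
Lemma L2_reprZ a u : {ae mu, forall x, L2_repr (a *: u) x = a * L2_repr u x}.
Proof. exact: L2_lmulE. Qed.
Lemma L2_reprR u a :
  {ae mu, forall x, L2_repr (L2_rmul u a) x = L2_repr u x * a}.
Proof. exact: L2_rmulE. Qed.

Definition L2_norm (u : L2) : R :=
  Num.sqrt (fine (\int[mu]_x (cl_norm (L2_repr u x) ^+ 2)%:E)%E).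

(* Partially defined operators are identified with their graphs, so that
   equality of operators includes equality of domains. *)
Definition operator := set (L2 * L2).
Implicit Types (S T : operator).

Definition op_graph (F : L2 -> L2) : operator := [set p | p.2 = F p.1].
Definition op_dom T : set L2 := [set u | exists v, T (u, v)].
Definition op_add S T : operator :=
  [set p | exists v w, [/\ S (p.1, v), T (p.1, w) & p.2 = v + w]].
Definition op_sub S T : operator :=
  [set p | exists v w, [/\ S (p.1, v), T (p.1, w) & p.2 = v - w]].
Definition op_comp S T : operator :=
  [set p | exists2 v, T (p.1, v) & S (v, p.2)].
Definition op_inv T : operator := [set p | T (p.2, p.1)].

(* With this multiplication operator, the products s T and T s
   are the compositions op_comp (op_lmul s) T and op_comp T (op_lmul s). *)
Definition op_lmul (a : Cl) : operator := op_graph (fun u => a *: u).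

Definition bounded_operators : set operator :=
  [set op_graph F | F in [set F : L2 -> L2 |
    [/\ forall u v, F (u + v) = F u + F v,
        forall u a, F (L2_rmul u a) = L2_rmul (F u) a
      & exists C : R, forall u, L2_norm (F u) <= C * L2_norm u]]].

Definition op_Q (s : Cl) T : operator :=
  op_add (op_sub (op_comp T T) (op_comp (op_lmul (2 * cl_re s)%:A) T))
         (op_lmul (cl_norm s ^+ 2)%:A).

Definition S_resolvent_set T : set Cl :=
  [set s | paravector s /\ bounded_operators (op_inv (op_Q s T))].
Definition S_spectrum T : set Cl := paravector `\` S_resolvent_set T.

Definition SL_resolvent (s : Cl) T : operator :=
  op_sub (op_comp (op_inv (op_Q s T)) (op_lmul (cl_conj s)))
         (op_comp T (op_inv (op_Q s T))).
Definition SR_resolvent (s : Cl) T : operator :=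
  op_comp (op_sub (op_lmul (cl_conj s)) T) (op_inv (op_Q s T)).

(* (u, v) is in the graph iff the class v is the class of g u; in particular
   the domain consists of the u in L^2 such that g u is in L^2. *)
Definition mul_op (g : X -> Cl) : operator :=
  [set p | {ae mu, forall x, L2_repr p.2 x = g x * L2_repr p.1 x}].

Definition essran (h : X -> Cl) : set Cl :=
  [set s | paravector s /\
    forall e : R, 0 < e -> (0 < mu [set x | cl_norm (h x - s) < e]%R)%E].

Lemma mul_op_dom (g : X -> Cl) (u : L2) : cl_measurable g ->
  op_dom (mul_op g) u <->
  (\int[mu]_x (cl_norm (g x * L2_repr u x) ^+ 2)%:E < +oo)%E.
Proof.
move=> mg; have mgu := cl_measurableM mg (L2_reprP u).1.
split=> [[v /= vE]|gu]; last first.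
  have sgu : square_integrable (fun x => g x * L2_repr u x) by [].
  by exists (L2_class sgu); exact: L2_classK.
have [mv] := L2_reprP v; suff -> : (\int[mu]_x (cl_norm (L2_repr v x) ^+ 2)%:E =
  \int[mu]_x (cl_norm (g x * L2_repr u x) ^+ 2)%:E)%E by [].
apply: ae_eq_integral => //.
- by apply/measurable_EFinP; exact: cl_measurable_norm_sqr.
- by apply/measurable_EFinP; exact: cl_measurable_norm_sqr.
- by apply: filterS vE => x ->.
Qed.

Lemma mul_op_functional (g : X -> Cl) (u v w : L2) :
  mul_op g (u, v) -> mul_op g (u, w) -> v = w.
Proof. by move=> uv uw; apply/L2_eqP; apply: filterS2 uv uw => x /= -> ->. Qed.

End HilbertModule.

Arguments mul_op {disp X R} mu {d} g.
Arguments essran {disp X R} mu {d} h.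
Arguments cl_measurable {disp X R d} f.

(* Main.v *)
Require Import Defs.
From mathcomp Require Import all_boot all_order all_algebra.
From mathcomp Require Import all_classical all_reals all_analysis measurable_realfun.
From mathcomp Require Import ring lra.
Set Implicit Arguments.
Unset Strict Implicit.
Unset Printing Implicit Defensive.
Import Order.TTheory GRing.Theory Num.Theory.
Import numFieldNormedType.Exports.
Local Open Scope classical_set_scope.
Local Open Scope ring_scope.

(** Let Q(x) = Qpoly s (h x). The proof reduces everything to one condition: |Q| is
    bounded below by a positive constant almost everywhere ([Q_bounded_below]).

    Paravectors obey q^2 = 2 q_0 q - |q|^2, so each of them lies in a copy of the
    complex plane. Let z and w be the complex numbers with real parts q_0 and s_0
    and with imaginary parts |Im q| and |Im s|. Then Qpoly s q is a paravector and
    |Qpoly s q| = |z - w| |z - conj w| ([Qpoly_norm_sqr]). Three facts follow. The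
    paravector zeros of Qpoly s are exactly the points of [s] ([Qpoly_sphere],
    [sphere_Qpoly]). The function |q|^2 is at most 2 |Qpoly s q| + 2 |s|^2
    ([norm_sqr_le_Qpoly]). A paravector p has inverse conj p / |p|^2
    ([paravector_inv]).

    If |Q| is bounded below, then 1/Q, h/Q and h^2/Q are bounded, so the operator
    Q_s of the multiplication by h is inverted by the bounded multiplication by 1/Q,
    domains included ([op_inv_Q]). The resolvent formulas then follow from the
    composition and subtraction of multiplication operators, in which
    boundedness of one factor guarantees equality of the domains. Conversely,
    if |Q| is not bounded below, then indicators of sets where |Q| is small
    contradict the boundedness of an inverse ([bounded_below_resolvent]);
    sigma-finiteness provides such sets of finite positive measure.

    Finally |Q| fails to be bounded below exactly when [s] meets the essential
    range. One direction is the continuity of Qpoly s ([hull_not_bounded_below]).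
    For the other, the values of h at points where |Q| is small accumulate, by
    compactness, at a point of [s] in the essential range
    ([not_bounded_below_hull]). *)

(** * Paravectors *)

Section Paravectors.
Context {R : realType} {d : nat}.
Local Notation Cl := (clifford R d).
Implicit Types (A : {set 'I_d}) (x y p q s t : Cl) (a b : R).

Lemma cl_coefD x y A : (x + y) A = x A + y A.
Proof. exact: ffunE. Qed.
Lemma cl_coefN x A : (- x) A = - x A.
Proof. exact: ffunE. Qed.
Lemma cl_coefZ a x A : (a *: x) A = a * x A.
Proof. exact: ffunE. Qed.
Lemma cl_coef1 A : (1 : Cl) A = (A == finset.set0)%:R.
Proof. by rewrite ffunE eq_sym. Qed.
Lemma cl_coef_gen i A : (cl_gen i : Cl) A = (A == [set i]%SET)%:R.
Proof. by rewrite ffunE eq_sym. Qed.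

Lemma cl_coef_im x A : cl_im x A = if #|A| == 1%N then x A else 0.
Proof.
rewrite sum_ffunE; under eq_bigr do rewrite cl_coefZ cl_coef_gen.
case: ifP => [/cards1P[i ->]|A1].
  rewrite (bigD1 i) //= eqxx mulr1 big1 ?addr0 // => j /negPf ji.
  by rewrite (inj_eq set1_inj) eq_sym ji mulr0.
by apply: big1 => i _; case: eqP => [E|_]; [rewrite E cards1 in A1|rewrite mulr0].
Qed.

Lemma paravectorP x : paravector x <-> forall A, (1 < #|A|)%N -> x A = 0.
Proof.
split=> [-> A A1|x0].
  rewrite cl_coefD cl_coefZ cl_coef1 cl_coef_im; case: eqP => [E|_].
    by rewrite E cards0 in A1.
  by rewrite gtn_eqF // mulr0 addr0.
apply/ffunP => A; rewrite cl_coefD cl_coefZ cl_coef1 cl_coef_im.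
case: (ltngtP #|A| 1) => [|A1|/eqP A1].
- by rewrite ltnS leqn0 cards_eq0 => /eqP ->; rewrite eqxx mulr1 addr0.
- rewrite x0 // addr0; case: eqP => [E|_]; last by rewrite mulr0.
  by rewrite E cards0 in A1.
- case: eqP => [E|_]; last by rewrite mulr0 add0r.
  by rewrite E cards0 in A1.
Qed.


Lemma paravectorD x y : paravector x -> paravector y -> paravector (x + y).
Proof.
move=> /paravectorP x0 /paravectorP y0; apply/paravectorP => A A1.
by rewrite cl_coefD x0 // y0 // addr0.
Qed.
Lemma paravectorZ a x : paravector x -> paravector (a *: x).
Proof.
by move=> /paravectorP x0; apply/paravectorP => A A1; rewrite cl_coefZ x0 ?mulr0.
Qed.
Lemma paravector1 : paravector (1 : Cl).
Proof.
apply/paravectorP => A; rewrite cl_coef1; case: eqP => // ->.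
by rewrite cards0.
Qed.
Lemma paravector_im x : paravector (cl_im x).
Proof. by apply/paravectorP => A A1; rewrite cl_coef_im gtn_eqF. Qed.

Lemma cl_reD x y : cl_re (x + y) = cl_re x + cl_re y.
Proof. exact: cl_coefD. Qed.
Lemma cl_reZ a x : cl_re (a *: x) = a * cl_re x.
Proof. exact: cl_coefZ. Qed.
Lemma cl_re1 : cl_re (1 : Cl) = 1.
Proof. by rewrite /cl_re cl_coef1 eqxx. Qed.
Lemma cl_re_im x : cl_re (cl_im x) = 0.
Proof. by rewrite /cl_re cl_coef_im cards0. Qed.
Lemma cl_imD x y : cl_im (x + y) = cl_im x + cl_im y.
Proof.
rewrite /cl_im -big_split /=; apply: eq_bigr => i _.
by rewrite cl_coefD scalerDl.
Qed.
Lemma cl_imZ a x : cl_im (a *: x) = a *: cl_im x.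
Proof.
by rewrite /cl_im scaler_sumr; apply: eq_bigr => i _; rewrite cl_coefZ scalerA.
Qed.
Lemma cl_im1 : cl_im (1 : Cl) = 0.
Proof.
rewrite /cl_im big1 // => i _; rewrite cl_coef1 -cards_eq0 cards1.
by rewrite scale0r.
Qed.

Lemma cl_normZ a x : cl_norm (a *: x) = `|a| * cl_norm x.
Proof.
rewrite /cl_norm; under eq_bigr do rewrite cl_coefZ exprMn.
by rewrite -mulr_sumr sqrtrM ?sqr_ge0 // sqrtr_sqr.
Qed.

Lemma cl_norm_im_sqr x : cl_norm (cl_im x) ^+ 2 = \sum_(i < d) x [set i]%SET ^+ 2.
Proof.
rewrite cl_norm_sqr.
under eq_bigr => A _ do rewrite cl_coef_im (fun_if (fun a => a ^+ 2)) expr0n /=.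
rewrite -big_mkcond /= (eq_bigl (mem [set [set i]%SET | i : 'I_d]%SET)).
  by rewrite big_imset /= => [|i j _ _ /set1_inj //]; apply: eq_bigl => i.
move=> A; apply/cards1P/imsetP => [[i ->]|[i _ ->]]; last by exists i.
by exists i.
Qed.

Lemma paravector_norm_sqr x : paravector x ->
  cl_norm x ^+ 2 = cl_re x ^+ 2 + cl_norm (cl_im x) ^+ 2.
Proof.
move=> /paravectorP x0; rewrite !cl_norm_sqr (bigD1 finset.set0) //=.
rewrite [in RHS](bigD1 finset.set0) //= cl_coef_im cards0 expr0n add0r.
congr (_ + _); apply: eq_bigr => A; rewrite cl_coef_im -card_gt0.
by case: (ltngtP #|A| 1) => [|A1|] //; rewrite x0.
Qed.

Lemma cl_norm_sqr_eq0 x : cl_norm x ^+ 2 = 0 -> x = 0.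
Proof.
move/eqP; rewrite cl_norm_sqr psumr_eq0 => [/allP x0|A _]; last exact: sqr_ge0.
apply/ffunP => A; rewrite ffunE; apply/eqP; rewrite -sqrf_eq0.
by apply: x0; rewrite mem_index_enum.
Qed.

Lemma cl_im_mull x y :
  cl_im x * y = \sum_(i < d) x [set i]%SET *: (cl_gen i * y).
Proof.
apply: (etrans (mulr_suml _ _ _ _)); apply: eq_bigr => i _.
by rewrite -scalerAl.
Qed.
Lemma cl_im_mulr x y :
  y * cl_im x = \sum_(i < d) x [set i]%SET *: (y * cl_gen i).
Proof.
apply: (etrans (mulr_sumr _ _ _ _)); apply: eq_bigr => i _.
by rewrite -scalerAr.
Qed.

(** Twice the square is a sum of anticommutators of generators, and these
    vanish off the diagonal. *)
Lemma cl_im_sqr x : cl_im x * cl_im x = - (cl_norm (cl_im x) ^+ 2)%:A.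
Proof.
have two_neq0 : (2 : R) != 0 by [].
apply: (scalerI two_neq0); rewrite scalerN scalerA cl_norm_im_sqr.
rewrite !scaler_nat mulr2n.
rewrite {1}cl_im_mull cl_im_mulr -big_split /=.
rewrite mulr_sumr scaler_suml -sumrN.
pose c i j := x [set i]%SET * x [set j]%SET.
transitivity (\sum_i \sum_j c i j *: (cl_gen i * cl_gen j + cl_gen j * cl_gen i)).
  apply: eq_bigr => i _; rewrite cl_im_mull cl_im_mulr -scalerDr -big_split /=.
  rewrite scaler_sumr; apply: eq_bigr => j _.
  by rewrite -scalerDr scalerA.
apply: eq_bigr => i _; rewrite (bigD1 i) //= big1 ?addr0 => [|j ji].
  by rewrite cl_gen_sqr -opprD scalerN -mulr2n -scaler_nat scalerA mulrC expr2.
by rewrite (cl_genC ji) subrr scaler0.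
Qed.

(** This quadratic equation is what makes a paravector behave like a complex
    number. *)
Lemma paravector_sqr q : paravector q ->
  q ^+ 2 = (2 * cl_re q) *: q - (cl_norm q ^+ 2)%:A.
Proof.
move=> pq; rewrite (paravector_norm_sqr pq) {1 3}pq expr2.
set a := cl_re q; set v := cl_im q; set b := cl_norm v ^+ 2.
rewrite mulrDl !mulrDr -!scalerAl !mul1r -scalerAr mulr1 cl_im_sqr -/v -/b.
by apply/ffunP => A; rewrite !(cl_coefD, cl_coefN, cl_coefZ); ring.
Qed.

(** Hence Qpoly s q is again a paravector, with an explicit norm and an explicit
    inverse. *)
Lemma QpolyE s q : paravector q -> Qpoly s q =
  (2 * (cl_re q - cl_re s)) *: q + (cl_norm s ^+ 2 - cl_norm q ^+ 2)%:A.
Proof.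
move=> pq; rewrite /Qpoly (paravector_sqr pq); apply/ffunP => A.
by rewrite !(cl_coefD, cl_coefN, cl_coefZ); ring.
Qed.

Lemma paravector_Qpoly s q : paravector q -> paravector (Qpoly s q).
Proof.
move=> pq; rewrite QpolyE //; apply: paravectorD; apply: paravectorZ => //.
exact: paravector1.
Qed.

(** Both a and b below are nonnegative, and they are the imaginary parts of
    the complex numbers z and w that represent q and s in a half-plane: the
    right-hand side is |z - w|^2 times |z - conj w|^2. *)
Lemma Qpoly_norm_sqr s q : paravector s -> paravector q ->
  let a := cl_norm (cl_im s) in let b := cl_norm (cl_im q) in
  cl_norm (Qpoly s q) ^+ 2 =
    ((cl_re q - cl_re s) ^+ 2 + (b - a) ^+ 2) *
    ((cl_re q - cl_re s) ^+ 2 + (b + a) ^+ 2).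
Proof.
move=> ps pq a b; rewrite (paravector_norm_sqr (paravector_Qpoly s pq)) QpolyE //.
rewrite cl_reD !cl_reZ cl_re1 cl_imD !cl_imZ cl_im1.
rewrite scaler0 addr0 cl_normZ exprMn real_normK ?num_real //.
rewrite (paravector_norm_sqr ps) (paravector_norm_sqr pq) -/a -/b.
by ring.
Qed.
End Paravectors.

(** * The quadratic polynomial of a sphere *)

Section QuadraticPolynomial.
Context {R : realType} {d : nat}.
Local Notation Cl := (clifford R d).
Implicit Types (A : {set 'I_d}) (x y p q s t : Cl) (a b : R).

Lemma paravector_conjE p : paravector p -> cl_conj p = (2 * cl_re p)%:A - p.
Proof.
move=> /paravectorP p0; apply/ffunP => A.
rewrite ffunE cl_coefD cl_coefN cl_coefZ cl_coef1.
case: (eqVneq A finset.set0) => [->|A0].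
  by rewrite cards0 mul0n expr0 mul1r mulr1 /cl_re; ring.
rewrite mulr0 add0r; case: (ltngtP #|A| 1) => [|A1|->].
- by rewrite ltnS leqn0 cards_eq0 (negPf A0).
- by rewrite p0 // mulr0 oppr0.
- by rewrite expr1 mulN1r.
Qed.

Lemma paravector_mul_conj p : paravector p -> p * cl_conj p = (cl_norm p ^+ 2)%:A.
Proof.
move=> pp; rewrite paravector_conjE // mulrBr -scalerAr mulr1 -expr2.
by rewrite paravector_sqr // subKr.
Qed.
Lemma paravector_conj_mul p : paravector p -> cl_conj p * p = (cl_norm p ^+ 2)%:A.
Proof.
move=> pp; rewrite paravector_conjE // mulrBl -scalerAl mul1r -expr2.
by rewrite paravector_sqr // subKr.
Qed.

Lemma cl_norm_conj x : cl_norm (cl_conj x) = cl_norm x.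
Proof.
by congr Num.sqrt; apply: eq_bigr => A _; rewrite ffunE exprMn sqrr_sign mul1r.
Qed.

Lemma cl_norm0 : cl_norm (0 : Cl) = 0.
Proof. by rewrite -[0 in LHS](scale0r 1) cl_normZ normr0 mul0r. Qed.

(** The identity also holds at p = 0, where both sides are 0. *)
Lemma paravector_inv p : paravector p -> p^-1 = (cl_norm p ^+ 2)^-1 *: cl_conj p.
Proof.
move=> pp; have [N0|N0] := eqVneq (cl_norm p ^+ 2) 0.
  by rewrite N0 invr0 scale0r (cl_norm_sqr_eq0 N0) invr0.
have pK : p * ((cl_norm p ^+ 2)^-1 *: cl_conj p) = 1.
  by rewrite -scalerAr paravector_mul_conj // scalerA mulVf // scale1r.
have Kp : ((cl_norm p ^+ 2)^-1 *: cl_conj p) * p = 1.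
  by rewrite -scalerAl paravector_conj_mul // scalerA mulVf // scale1r.
have up : p \is a GRing.unit by apply/unitrP; eexists; split; eassumption.
by apply: (mulrI up); rewrite mulrV // pK.
Qed.

Lemma paravector_unit p : paravector p -> cl_norm p ^+ 2 != 0 -> p \is a GRing.unit.
Proof.
move=> pp N0; apply/unitrP; exists ((cl_norm p ^+ 2)^-1 *: cl_conj p).
rewrite -scalerAr -scalerAl paravector_mul_conj // paravector_conj_mul //.
by rewrite scalerA mulVf // scale1r.
Qed.

Lemma paravector_norm_inv p : paravector p -> cl_norm p^-1 = (cl_norm p)^-1.
Proof.
move=> pp; rewrite paravector_inv // cl_normZ cl_norm_conj ger0_norm; last first.
  by rewrite invr_ge0 sqr_ge0.
have [->|N0] := eqVneq (cl_norm p) 0; first by rewrite mulr0 invr0.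
by rewrite expr2 invfM mulfVK.
Qed.

(** With z, w as in [Qpoly_norm_sqr], nonnegativity of the imaginary parts
    gives |z - w| <= |z - conj w|. *)
Lemma Qpoly_norm_ge s q : paravector s -> paravector q ->
  (cl_re q - cl_re s) ^+ 2 + (cl_norm (cl_im q) - cl_norm (cl_im s)) ^+ 2
  <= cl_norm (Qpoly s q).
Proof.
move=> ps pq; rewrite -(ler_pXn2r (ltn0Sn 1)) ?nnegrE ?cl_norm_ge0 //; last first.
  by rewrite addr_ge0 ?sqr_ge0.
rewrite Qpoly_norm_sqr // expr2 ler_wpM2l ?addr_ge0 ?sqr_ge0 //.
have := cl_norm_ge0 (cl_im q); have := cl_norm_ge0 (cl_im s).
move: (cl_norm _) (cl_norm _) => a b a0 b0.
rewrite lerD2l -subr_ge0 (_ : _ - _ = 4 * (a * b)); last by ring.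
by rewrite mulr_ge0 // mulr_ge0.
Qed.

(** As |z - w|^2 <= |Qpoly s q| in the notation of [Qpoly_norm_sqr], this is
    |z|^2 <= 2 |z - w|^2 + 2 |w|^2. For a function h it gives a bound on h where
    Qpoly s h is small, and a bound of |h|^2 by a multiple of |Qpoly s h| where the
    latter is bounded away from 0. *)
Lemma norm_sqr_le_Qpoly s q : paravector s -> paravector q ->
  cl_norm q ^+ 2 <= 2 * cl_norm (Qpoly s q) + 2 * cl_norm s ^+ 2.
Proof.
move=> ps pq; have := Qpoly_norm_ge ps pq.
rewrite (paravector_norm_sqr ps) (paravector_norm_sqr pq).
move: (cl_re q) (cl_re s) (cl_norm (cl_im q)) (cl_norm (cl_im s)) (cl_norm (Qpoly s q)).
move=> q0 s0 b a N.
have := sqr_ge0 (q0 - 2 * s0); have := sqr_ge0 (b - 2 * a).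
nra.
Qed.

Lemma paravector_sphere s t : cl_sphere s t -> paravector t.
Proof.
move=> [J [pJ _ _] <-]; apply: paravectorD; apply: paravectorZ => //.
exact: paravector1.
Qed.

Lemma Qpoly_sphere s t : paravector s -> cl_sphere s t -> Qpoly s t = 0.
Proof.
move=> ps st; have pt := paravector_sphere st.
apply: cl_norm_sqr_eq0; rewrite Qpoly_norm_sqr //.
case: st => J [pJ J0 J1] <-.
have imJ : cl_im J = J by rewrite [RHS]pJ J0 scale0r add0r.
rewrite cl_reD !cl_reZ cl_re1 cl_imD !cl_imZ cl_im1 J0 imJ.
rewrite scaler0 add0r cl_normZ J1 mulr1 mulr0 addr0 mulr1.
by rewrite ger0_norm ?cl_norm_ge0 // !subrr expr0n addr0 mul0r.
Qed.

Lemma cl_norm_im_gen i : cl_norm (cl_im (cl_gen i : Cl)) = 1.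
Proof.
apply/eqP; rewrite -(eqrXn2 (ltn0Sn 1)) ?cl_norm_ge0 // expr1n cl_norm_im_sqr.
rewrite (bigD1 i) //= cl_coef_gen eqxx expr1n big1 ?addr0 // => j ji.
by rewrite cl_coef_gen (inj_eq set1_inj) (negPf ji) expr0n.
Qed.

Lemma sphere_Qpoly s t : (0 < d)%N -> paravector s -> paravector t ->
  Qpoly s t = 0 -> cl_sphere s t.
Proof.
move=> d0 ps pt Q0.
have := Qpoly_norm_ge ps pt; rewrite Q0 cl_norm0 => le0.
have := sqr_ge0 (cl_re t - cl_re s).
have := sqr_ge0 (cl_norm (cl_im t) - cl_norm (cl_im s)).
move=> im_ge0 re_ge0.
have /eqP : (cl_re t - cl_re s) ^+ 2 = 0 by lra.
rewrite sqrf_eq0 subr_eq0 => /eqP re_ts.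
have /eqP : (cl_norm (cl_im t) - cl_norm (cl_im s)) ^+ 2 = 0 by lra.
rewrite sqrf_eq0 subr_eq0 => /eqP im_ts.
have [N0|N0] := eqVneq (cl_norm (cl_im t)) 0.
  (* Here [s] is a single real point, and any imaginary unit represents it. *)
  exists (cl_im (cl_gen (Ordinal d0))).
    split; [exact: paravector_im|exact: cl_re_im|].
    exact: cl_norm_im_gen.
  rewrite -im_ts N0 scale0r addr0 -re_ts [RHS]pt.
  by rewrite (_ : cl_im t = 0) ?addr0 //; apply: cl_norm_sqr_eq0; rewrite N0 expr0n.
exists ((cl_norm (cl_im t))^-1 *: cl_im t).
  split; first by apply: paravectorZ; exact: paravector_im.
    by rewrite cl_reZ cl_re_im mulr0.
  by rewrite cl_normZ ger0_norm ?invr_ge0 ?cl_norm_ge0 // mulVf.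
by rewrite -im_ts scalerA mulfV // scale1r -re_ts -pt.
Qed.

(** With e = q - t the difference is t e + e t + e^2 - 2 s_0 e, since q and t
    need not commute. *)
Lemma Qpoly_lipschitz s t : exists2 C, 0 <= C & forall q, cl_norm (q - t) ^+ 2 <= 1 ->
  cl_norm (Qpoly s q - Qpoly s t) ^+ 2 <= C * cl_norm (q - t) ^+ 2.
Proof.
pose K : R := (#|{set 'I_d}| ^ 3)%:R.
have K0 : 0 <= K by exact: ler0n.
exists (8 * K * cl_norm t ^+ 2 + 4 * K + 16 * cl_re s ^+ 2).
  by repeat first [done | exact: sqr_ge0 | apply: addr_ge0 | apply: mulr_ge0].
move=> q; set e := q - t; have -> : q = t + e by rewrite addrC subrK.
move=> e1.
have -> : Qpoly s (t + e) - Qpoly s t = (t * e + e * t) + (e * e - (2 * cl_re s) *: e).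
  rewrite /Qpoly expr2 mulrDl !mulrDr -expr2; apply/ffunP => A.
  by rewrite !(cl_coefD, cl_coefN, cl_coefZ); ring.
have := cl_normD_sqr (t * e + e * t) (e * e - (2 * cl_re s) *: e).
have := cl_normD_sqr (t * e) (e * t).
have := cl_normD_sqr (e * e) (- ((2 * cl_re s) *: e)).
rewrite cl_normN cl_normZ exprMn real_normK ?num_real //.
have := cl_normM_sqr t e; have := cl_normM_sqr e t; have := cl_normM_sqr e e.
rewrite -/K; move: K0.
have : cl_norm e ^+ 2 * cl_norm e ^+ 2 <= cl_norm e ^+ 2.
  by rewrite ler_piMr ?sqr_ge0.
move: (cl_norm (t * e + e * t + _) ^+ 2) (cl_norm (t * e + e * t) ^+ 2).
move: (cl_norm (e * e + _) ^+ 2) (cl_norm (e * e) ^+ 2).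
move: (cl_norm (t * e) ^+ 2) (cl_norm (e * t) ^+ 2).
move: (cl_norm e ^+ 2) (cl_norm t ^+ 2) K (cl_re s).
move=> e2 t2 k s0 TE ET EE Y X Z ee k0 kee ket kte hY hX hZ.
have kee' : k * (e2 * e2) <= k * e2 by rewrite ler_wpM2l.
by lra.
Qed.

End QuadraticPolynomial.

(** * Multiplication operators on L^2 *)

Section MultiplicationOperators.
Context {disp : measure_display} {X : measurableType disp} {R : realType}.
Context (mu : {measure set X -> \bar R}) (d : nat).
Local Notation Cl := (clifford R d).
Local Notation L2 := (L2 mu d).
Implicit Types (f g h : X -> Cl) (u v w : L2) (a s : Cl).

Lemma L2_reprB u v :
  {ae mu, forall x, L2_repr (u - v) x = L2_repr u x - L2_repr v x}.
Proof.
have := L2_reprD u (- v); have := L2_reprZ (-1) v; rewrite scaleN1r.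
by apply: filterS2 => x -> ->; rewrite mulN1r.
Qed.

Lemma integral_norm_sqr_ge0 f :
  (\int[mu]_x (cl_norm (f x) ^+ 2)%:E >= 0)%E.
Proof. by apply: integral_ge0 => x _; rewrite lee_fin sqr_ge0. Qed.

Lemma integral_norm_sqr_le f g (C : R) : cl_measurable f -> cl_measurable g ->
  0 <= C -> {ae mu, forall x, cl_norm (f x) ^+ 2 <= C * cl_norm (g x) ^+ 2} ->
  (\int[mu]_x (cl_norm (f x) ^+ 2)%:E <= C%:E * \int[mu]_x (cl_norm (g x) ^+ 2)%:E)%E.
Proof.
move=> mf mg C0 fg; rewrite -ge0_integralZl_EFin //; first last.
- by apply/measurable_EFinP; exact: cl_measurable_norm_sqr.
- by move=> x _; rewrite lee_fin sqr_ge0.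
apply: ae_ge0_le_integral => //.
- by move=> x _; rewrite lee_fin sqr_ge0.
- by apply/measurable_EFinP; exact: cl_measurable_norm_sqr.
- by move=> x _; rewrite -EFinM lee_fin mulr_ge0 ?sqr_ge0.
- apply/measurable_EFinP; apply: measurable_funM; first exact: measurable_cst.
  exact: cl_measurable_norm_sqr.
- by apply: filterS fg => x fgx _; rewrite -EFinM lee_fin.
Qed.

Lemma L2_norm_sqrE u :
  (L2_norm u ^+ 2)%:E = (\int[mu]_x (cl_norm (L2_repr u x) ^+ 2)%:E)%E.
Proof.
have [_ ufin] := L2_reprP u; have u0 := integral_norm_sqr_ge0 (L2_repr u).
by rewrite sqr_sqrtr ?fine_ge0 // fineK // ge0_fin_numE.
Qed.

Lemma L2_norm_sqr_le u v (C : R) : 0 <= C ->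
  {ae mu, forall x, cl_norm (L2_repr v x) ^+ 2 <= C * cl_norm (L2_repr u x) ^+ 2} ->
  L2_norm v ^+ 2 <= C * L2_norm u ^+ 2.
Proof.
move=> C0 vu; rewrite -lee_fin (EFinM C) !L2_norm_sqrE.
by apply: integral_norm_sqr_le => //; exact: (L2_reprP _).1.
Qed.

Lemma L2_norm_sqr_eq0 u : L2_norm u ^+ 2 = 0 -> {ae mu, forall x, L2_repr u x = 0}.
Proof.
move=> u0; have mu2 : measurable_fun setT (fun x => (cl_norm (L2_repr u x) ^+ 2)%:E).
  by apply/measurable_EFinP; apply: cl_measurable_norm_sqr; exact: (L2_reprP u).1.
have /ae_eq_integral_abs := mu2; move=> /(_ mu measurableT)[H _].
have : ae_eq mu setT (fun x => (cl_norm (L2_repr u x) ^+ 2)%:E) (cst 0%R).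
  apply: H; rewrite -[RHS]/(0%:E) -u0 L2_norm_sqrE.
  by apply: eq_integral => x _; rewrite gee0_abs // lee_fin sqr_ge0.
by apply: filterS => x /(_ I) ux; apply: cl_norm_sqr_eq0; exact: (EFin_inj ux).
Qed.

(** The bound is put on the square of the norm because that is what is integrated
    and what [cl_normM_sqr] controls. *)
Definition ae_bounded g :=
  exists C : R, {ae mu, forall x, cl_norm (g x) ^+ 2 <= C}.

Lemma ae_boundedM f g : ae_bounded f -> ae_bounded g -> ae_bounded (fun x => f x * g x).
Proof.
move=> [C fC] [D gD]; exists ((#|{set 'I_d}| ^ 3)%:R * C * D).
apply: filterS2 fC gD => x fC gD; apply: (le_trans (cl_normM_sqr _ _)).
set K : R := _%:R; have K0 : 0 <= K by exact: ler0n.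
apply: ler_pM; [by rewrite mulr_ge0 ?sqr_ge0|exact: sqr_ge0| |by []].
by rewrite ler_wpM2l.
Qed.

Lemma ae_bounded_cst a : ae_bounded (fun=> a).
Proof. by exists (cl_norm a ^+ 2); exact: aeW. Qed.

Lemma ae_bounded_mul g : ae_bounded g -> exists2 C : R, 0 <= C &
  {ae mu, forall x, forall a, cl_norm (g x * a) ^+ 2 <= C * cl_norm a ^+ 2}.
Proof.
move=> [C gC]; exists ((#|{set 'I_d}| ^ 3)%:R * `|C|).
  by rewrite mulr_ge0 ?ler0n.
apply: filterS gC => x gC a; apply: (le_trans (cl_normM_sqr _ _)).
rewrite ler_wpM2r ?sqr_ge0 // ler_wpM2l ?ler0n //.
exact: (le_trans gC (ler_norm C)).
Qed.

Lemma mul_op_total g u : cl_measurable g -> ae_bounded g ->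
  exists v, mul_op mu g (u, v).
Proof.
move=> mg /ae_bounded_mul[C C0 gC].
apply/(mul_op_dom u mg); apply: le_lt_trans.
  apply: (integral_norm_sqr_le _ (L2_reprP u).1 C0).
    by apply: cl_measurableM => //; exact: (L2_reprP u).1.
  by apply: filterS gC => x; apply.
by rewrite lte_mul_pinfty //; exact: (L2_reprP u).2.
Qed.

Lemma op_lmulE a : op_lmul a = mul_op mu (fun=> a).
Proof.
apply/seteqP; split=> -[u v]; rewrite /op_lmul /op_graph /=.
  by move=> ->; exact: L2_reprZ.
by move=> uv; apply: (mul_op_functional uv); exact: L2_reprZ.
Qed.

(** In general the left-hand side has the smaller domain, as it also requires
    g u to be in L^2; boundedness of the inner factor removes that condition. *)
Lemma mul_op_comp f g : cl_measurable g -> ae_bounded g ->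
  op_comp (mul_op mu f) (mul_op mu g) = mul_op mu (fun x => f x * g x).
Proof.
move=> mg bg; apply/seteqP; split=> [[u w] /= [v]|[u w] /= uw].
  by apply: filterS2 => x /= -> ->; rewrite mulrA.
have [v uv] := mul_op_total u mg bg; exists v => //.
by apply: filterS2 uw uv => x /= -> ->; rewrite mulrA.
Qed.

(** If f is bounded then f u is always in L^2, so (f - g) u is in L^2 exactly
    when g u is. *)
Lemma mul_op_sub f g : cl_measurable f -> ae_bounded f ->
  op_sub (mul_op mu f) (mul_op mu g) = mul_op mu (fun x => f x - g x).
Proof.
move=> mf bf; apply/seteqP; split=> [[u w] /= [v1 [v2 [uv1 uv2 /= ->]]]|[u w] /= uw].
  apply: filterS3 uv1 uv2 (L2_reprB v1 v2) => x /= v1E v2E ->.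
  by rewrite v1E v2E mulrBl.
have [v uv] := mul_op_total u mf bf; exists v, (v - w); split=> //.
  apply: filterS3 uw uv (L2_reprB v w) => x /= wE vE ->.
  by rewrite wE vE mulrBl subKr.
by rewrite subKr.
Qed.

Lemma mul_op_inv g : {ae mu, forall x, g x \is a GRing.unit} ->
  op_inv (mul_op mu g) = mul_op mu (fun x => (g x)^-1).
Proof.
move=> ug; apply/seteqP; split=> [[u v]|[u v]] /=; apply: filterS2 ug => x ux /= ->.
  by rewrite mulKr.
by rewrite mulVKr.
Qed.

Lemma mul_op_bounded g : cl_measurable g -> ae_bounded g ->
  bounded_operators (mul_op mu g).
Proof.
move=> mg bg; have [F FP] := choice (fun u => mul_op_total u mg bg).
exists F; last first.
  apply/seteqP; split=> -[u v]; rewrite /op_graph /=.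
    by move=> ->; exact: FP.
  by move=> uv; exact: (mul_op_functional uv (FP u)).
have [C C0 gC] := ae_bounded_mul bg; split.
- move=> u v; apply: (mul_op_functional (FP (u + v))).
  apply: filterS3 (L2_reprD u v) (L2_reprD (F u) (F v)) (filterI (FP u) (FP v)).
  by move=> x /= -> -> [-> ->]; rewrite mulrDr.
- move=> u a; apply: (mul_op_functional (FP (L2_rmul u a))).
  apply: filterS3 (L2_reprR u a) (L2_reprR (F u) a) (FP u).
  by move=> x /= -> -> ->; rewrite mulrA.
exists (Num.sqrt C) => u.
rewrite -(ler_pXn2r (ltn0Sn 1)) ?nnegrE ?mulr_ge0 ?sqrtr_ge0 //.
rewrite exprMn (sqr_sqrtr C0) //; apply: L2_norm_sqr_le => //.
by apply: filterS2 gC (FP u) => x gC /= ->.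
Qed.

(** Only an inclusion of graphs: the domain of [op_Q] asks for h u and h^2 u to
    be in L^2, while u may lie in the domain of the multiplication by Qpoly s h
    thanks to cancellation in the polynomial. [op_Q_intro] is the converse on the
    domain of the square. *)
Lemma op_Q_sub_mul h s u v : op_Q s (mul_op mu h) (u, v) ->
  mul_op mu (fun x => Qpoly s (h x)) (u, v).
Proof.
move=> [y [z [/= [y1 [y2 [[w uw wy1] [w' uw' wy2] /= ->]]] zE /= ->]]].
rewrite /op_lmul /op_graph /= in wy2 zE; rewrite {}zE.
have {uw' wy2}-> : y2 = (2 * cl_re s)%:A *: w.
  by rewrite wy2 (mul_op_functional uw uw').
apply: filterS3 (filterI uw wy1)
 (L2_reprD (y1 - (2 * cl_re s)%:A *: w) ((cl_norm s ^+ 2)%:A *: u))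
 (filterI (L2_reprB y1 ((2 * cl_re s)%:A *: w))
   (filterI (L2_reprZ (2 * cl_re s)%:A w) (L2_reprZ (cl_norm s ^+ 2)%:A u))).
move=> x /= [wE y1E] -> [-> [-> ->]]; rewrite y1E wE /Qpoly.
rewrite [in RHS](mulrDl _ _ (L2_repr u x)) [in RHS](mulrBl (L2_repr u x)).
by rewrite expr2 mulrA -!scalerAl !mul1r.
Qed.

Lemma op_Q_intro h s u w y v : mul_op mu h (u, w) -> mul_op mu h (w, y) ->
  mul_op mu (fun x => Qpoly s (h x)) (u, v) -> op_Q s (mul_op mu h) (u, v).
Proof.
move=> uw wy uv.
pose v' := (y - (2 * cl_re s)%:A *: w) + (cl_norm s ^+ 2)%:A *: u.
have uv' : op_Q s (mul_op mu h) (u, v').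
  exists (y - (2 * cl_re s)%:A *: w), ((cl_norm s ^+ 2)%:A *: u); split=> //.
  exists y, ((2 * cl_re s)%:A *: w); split=> //; by exists w.
by rewrite (mul_op_functional uv (op_Q_sub_mul uv')).
Qed.

End MultiplicationOperators.

(** * Compactness of bounded sets of paravectors *)

Section ParavectorCompactness.
Context {R : realType} {d : nat}.
Local Notation Cl := (clifford R d).

Lemma exists_small_sqr (C e : R) : 0 <= C -> 0 < e ->
  exists r, [/\ 0 < r, r <= 1 & C * r ^+ 2 < e ^+ 2].
Proof.
move=> C0 e0; have C1 : 0 < 1 + C by rewrite ltr_pwDl.
pose r0 := e / (1 + C); have r00 : 0 < r0 by rewrite divr_gt0.
have eE : e = r0 * (1 + C) by rewrite mulfVK // gt_eqF.
exists (Num.min r0 1); rewrite lt_min r00 ltr01 ge_min lexx orbT; split => //.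
set r := Num.min r0 1; have r_ge0 : 0 <= r by rewrite le_min ltW ?ler01.
have rr0 : r <= r0 by rewrite ge_min lexx.
apply: (@le_lt_trans _ _ (C * r0 ^+ 2)).
  by rewrite ler_wpM2l // lerXn2r ?nnegrE // ltW.
by rewrite eE; nra.
Qed.

Lemma cl_norm_lt (e : R) (x : Cl) : 0 <= e -> (cl_norm x < e) = (cl_norm x ^+ 2 < e ^+ 2).
Proof. by move=> e0; rewrite ltr_pXn2r ?nnegrE ?cl_norm_ge0. Qed.

Lemma cl_norm_lt_coef (e : R) : 0 < e -> exists2 r : R, 0 < r &
  forall x : Cl, (forall A, `|x A| < r) -> cl_norm x < e.
Proof.
move=> e0; have [r [r0 _ re]] := exists_small_sqr (ler0n R #|{set 'I_d}|) e0.
exists r => // x xr; rewrite cl_norm_lt ?(ltW e0) //; apply: le_lt_trans re.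
rewrite cl_norm_sqr mulr_natl -sumr_const; apply: ler_sum => A _.
by rewrite -real_normK ?num_real // lerXn2r ?nnegrE // ltW.
Qed.

(** Bolzano-Weierstrass for filters of paravectors, phrased with [cl_norm]. The
    coefficients embed the paravectors of norm at most M in a product of
    segments, which is compact by Tychonoff; the segments at the indices A with
    #|A| > 1 are reduced to 0, so that the cluster point is a paravector. *)
Lemma paravector_cluster (F : set_system Cl) (FF : ProperFilter F) (M : R) :
  F [set q | paravector q /\ cl_norm q <= M] ->
  exists2 t : Cl, paravector t &
    forall B e, F B -> 0 < e -> exists2 q, B q & cl_norm (q - t) < e.
Proof.
move=> FM; pose coefs (q : Cl) : {ptws {set 'I_d} -> R} := fun A => q A.
pose bound (A : {set 'I_d}) : R := if (1 < #|A|)%N then 0 else M.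
have box : (coefs @ F) [set f | forall A, `[- bound A, bound A]%classic (f A)].
  apply: (@filterS _ F _ _ _ _ FM) => q [/paravectorP q0 qM] A /=.
  rewrite in_itv /= -ler_norml /bound; case: ifP => [/q0 qA0|_].
    by rewrite /coefs qA0 normr0.
  exact: le_trans (cl_coef_le q A) qM.
have Fco : ProperFilter (coefs @ F) by exact: fmap_proper_filter.
have [t [tb tcl]] :=
  tychonoff (fun A => @segment_compact R (- bound A) (bound A)) Fco box.
exists [ffun A => t A].
  apply/paravectorP => A A1; rewrite ffunE; have := tb A.
  by rewrite /bound A1 /= oppr0 in_itv /= -eq_le => /eqP.
move=> B e FB /cl_norm_lt_coef[r r0 re].
have FB' : (coefs @ F) (coefs @` B).
  by apply: (@filterS _ F _ _ _ _ FB) => q Bq; exists q.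
have nt : nbhs (t : {ptws {set 'I_d} -> R})
   [set f : {ptws {set 'I_d} -> R} | forall A, `|f A - t A| < r].
  apply: (@filter_forall _ _
      (fun A => [set f : {ptws {set 'I_d} -> R} | `|f A - t A| < r]) _
      (nbhs_filter (t : {ptws {set 'I_d} -> R}))) => A.
  have tA : nbhs (t A) [set y | `|y - t A| < r].
    by apply: filterS (nbhsx_ballx (t A) r r0) => y; rewrite /ball /= distrC.
  exact: (@proj_continuous _ (fun=> R) A t _ tA).
have [_ [[q Bq <-] qt]] := tcl _ _ FB' nt.
exists q => //; apply: re => A; rewrite cl_coefD cl_coefN ffunE; exact: qt.
Qed.
End ParavectorCompactness.

(** * Measurability and indicator functions *)

Section EssentialRangeAndResolvent.
Context {disp : measure_display} {X : measurableType disp} {R : realType}.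
Context (mu : {measure set X -> \bar R}) (d : nat).
Local Notation Cl := (clifford R d).
Local Notation L2 := (L2 mu d).
Implicit Types (f g : X -> Cl) (u v w : L2) (a s t : Cl).

Lemma cl_measurableZl (c : X -> R) f : measurable_fun setT c -> cl_measurable f ->
  cl_measurable (fun x => c x *: f x).
Proof.
by move=> mc mf A; under eq_fun do rewrite cl_coefZ; exact: measurable_funM.
Qed.

Lemma cl_measurable_conj f : cl_measurable f -> cl_measurable (fun x => cl_conj (f x)).
Proof.
move=> mf A; under eq_fun do rewrite ffunE; apply: measurable_funM => //.
Qed.

(** The inverse of a nonnegative real is its power -1, including at 0. *)
Lemma cl_measurable_inv f : cl_measurable f -> (forall x, paravector (f x)) ->
  cl_measurable (fun x => (f x)^-1).
Proof.
move=> mf pf; under eq_fun do rewrite paravector_inv //.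
apply: cl_measurableZl; last exact: cl_measurable_conj.
under eq_fun do rewrite -powR_inv1 ?sqr_ge0 //.
apply: (measurableT_comp (measurable_powR _)).
exact: cl_measurable_norm_sqr.
Qed.

Lemma cl_measurable_Qpoly s f : cl_measurable f ->
  cl_measurable (fun x => Qpoly s (f x)).
Proof.
move=> mf; apply: cl_measurableD; last exact: cl_measurable_cst.
apply: cl_measurableD; first exact: cl_measurableM.
by apply: cl_measurableN; apply: cl_measurableZl.
Qed.

Lemma measurable_norm_lt f (e : R) : cl_measurable f -> 0 <= e ->
  measurable [set x | cl_norm (f x) < e].
Proof.
move=> mf e0; have := cl_measurable_norm_sqr mf.
move=> /(_ measurableT _ (measurable_itv `]-oo, (e ^+ 2)[)); rewrite setTI.
congr measurable; apply/seteqP; split=> x /=; rewrite in_itv /= cl_norm_lt //.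
Qed.

Lemma ae_norm_geP f (e : R) :
  {ae mu, forall x, e <= cl_norm (f x)} <-> mu.-negligible [set x | cl_norm (f x) < e].
Proof.
rewrite /almost_everywhere; suff <- : ~` [set x | e <= cl_norm (f x)] =
   [set x | cl_norm (f x) < e] by [].
by apply/seteqP; split=> x /=; rewrite ltNge => /negP.
Qed.

(** Otherwise B would be a countable union of negligible sets. *)
Lemma sigma_finite_subset (B : set X) : sigma_finite setT mu -> measurable B ->
  ~ mu.-negligible B ->
  exists2 E : set X, E `<=` B & [/\ measurable E, (mu E < +oo)%E & ~ mu.-negligible E].
Proof.
move=> [F FT Ffin] mB nB; apply: contrapT => nE; apply: nB.
rewrite -(setIT B) FT setI_bigcupr; apply: negligible_bigcup => k.
apply: contrapT => nk; apply: nE; exists (B `&` F k); first exact: subIsetl.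
have [mF Fk] := Ffin k; split=> //; first exact: measurableI.
by apply: le_lt_trans Fk; apply: le_measure; rewrite ?inE //; exact: measurableI.
Qed.

Section Indicator.
Context (B : set X) (mB : measurable B) (Bfin : (mu B < +oo)%E).

Definition cl_indic x : Cl := \1_B x *: 1.

Lemma square_integrable_indic : square_integrable mu cl_indic.
Proof.
split.
  by apply: cl_measurableZl; [exact: measurable_indic|exact: cl_measurable_cst].
have E x : cl_norm (cl_indic x) ^+ 2 = \1_B x.
  rewrite paravector_norm_sqr; last by apply: paravectorZ; exact: paravector1.
  rewrite cl_reZ cl_re1 cl_imZ cl_im1 scaler0 cl_norm0 expr0n addr0 mulr1.
  by rewrite indicE; case: (_ \in _); rewrite ?expr1n ?expr0n.
by under eq_integral do rewrite E; rewrite integral_indic // setIT.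
Qed.

Definition L2_indic : L2 := L2_class square_integrable_indic.

Lemma L2_indicE : {ae mu, forall x, L2_repr L2_indic x = cl_indic x}.
Proof. exact: L2_classK. Qed.

(** Multiplication by g maps functions supported in B to such functions as
    soon as g is bounded on B. *)
Lemma mul_op_supported g u (C : R) : cl_measurable g ->
  (forall x, B x -> cl_norm (g x) ^+ 2 <= C) ->
  {ae mu, forall x, ~ B x -> L2_repr u x = 0} ->
  exists2 v, mul_op mu g (u, v) & {ae mu, forall x, ~ B x -> L2_repr v x = 0}.
Proof.
move=> mg gC uB.
have mBg : cl_measurable (fun x => \1_B x *: g x).
  by apply: cl_measurableZl => //; exact: measurable_indic.
have bBg : ae_bounded mu (fun x => \1_B x *: g x).
  exists `|C|; apply: aeW => x; rewrite cl_normZ exprMn real_normK ?num_real //.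
  rewrite indicE; case: (boolP (x \in B)) => [|_]; last by rewrite expr0n mul0r.
  by rewrite inE expr1n mul1r => /gC /le_trans; apply; exact: ler_norm.
have [v uv] := mul_op_total u mBg bBg; exists v; apply: filterS2 uB uv => x /= uB ->.
  rewrite indicE; case: (boolP (x \in B)); rewrite ?scale1r //.
  by rewrite notin_setE => /uB ->; rewrite !mulr0.
by move=> /uB ->; rewrite mulr0.
Qed.
End Indicator.

(** * Resolvent set and essential range *)

Section Resolvent.
Context (h : X -> Cl) (mh : cl_measurable h) (ph : forall x, paravector (h x)).
Context (s : Cl) (ps : paravector s).

(** The analytic condition to which both the membership of s in the resolvent
    set and the disjointness of [s] from the essential range are reduced. *)
Definition Q_bounded_below := exists2 e : R, 0 < e &
  {ae mu, forall x, e <= cl_norm (Qpoly s (h x))}.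

Lemma cl_measurable_Qpoly_inv : cl_measurable (fun x => (Qpoly s (h x))^-1).
Proof.
apply: cl_measurable_inv => [|x]; first exact: cl_measurable_Qpoly.
exact: paravector_Qpoly.
Qed.

Section BoundedBelow.
Context (bb : Q_bounded_below).

Lemma Qpoly_unit : {ae mu, forall x, Qpoly s (h x) \is a GRing.unit}.
Proof.
have [e e0 Qe] := bb; apply: filterS Qe => x Qe.
apply: paravector_unit; first exact: paravector_Qpoly.
by rewrite expf_neq0 // gt_eqF // (lt_le_trans e0).
Qed.

Lemma Qpoly_inv_bounded : ae_bounded mu (fun x => (Qpoly s (h x))^-1).
Proof.
have [e e0 Qe] := bb; exists (e^-1 ^+ 2); apply: filterS Qe => x Qe.
rewrite paravector_norm_inv; last exact: paravector_Qpoly.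
have N0 := lt_le_trans e0 Qe.
by rewrite lerXn2r ?nnegrE ?invr_ge0 ?(ltW e0) ?(ltW N0) // lef_pV2.
Qed.

(** In [norm_sqr_le_Qpoly] the constant term is absorbed by Qpoly s h, which is
    bounded below. *)
Lemma Qpoly_dominates : exists2 c : R, 0 <= c &
  {ae mu, forall x, cl_norm (h x) ^+ 2 <= c * cl_norm (Qpoly s (h x))}.
Proof.
have [e e0 Qe] := bb; exists (2 + 2 * cl_norm s ^+ 2 / e).
  by rewrite addr_ge0 // divr_ge0 ?(ltW e0) // mulr_ge0 ?sqr_ge0.
apply: filterS Qe => x Qe; apply: (le_trans (norm_sqr_le_Qpoly ps (ph x))).
rewrite (mulrDl 2) lerD2l mulrAC ler_pdivlMr //.
by rewrite ler_wpM2l // mulr_ge0 ?sqr_ge0.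
Qed.

Lemma id_Qpoly_inv_bounded : ae_bounded mu (fun x => h x * (Qpoly s (h x))^-1).
Proof.
have [e e0 Qe] := bb; have [c c0 hc] := Qpoly_dominates.
exists ((#|{set 'I_d}| ^ 3)%:R * (c / e)); apply: filterS2 Qe hc => x Qe hc.
have N0 := lt_le_trans e0 Qe.
apply: (le_trans (cl_normM_sqr _ _)); rewrite -mulrA ler_wpM2l ?ler0n //.
rewrite paravector_norm_inv; last exact: paravector_Qpoly.
rewrite exprVn ler_pdivrMr ?exprn_gt0 //; apply: (le_trans hc).
rewrite -mulrA ler_wpM2l // mulrC expr2 -mulrA ler_peMr ?(ltW N0) //.
by rewrite ler_pdivlMr // mul1r.
Qed.

Lemma sqr_Qpoly_inv_bounded : ae_bounded mu (fun x => h x * (h x * (Qpoly s (h x))^-1)).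
Proof.
have [e e0 Qe] := bb; have [c c0 hc] := Qpoly_dominates.
pose K : R := (#|{set 'I_d}| ^ 3)%:R; have K0 : 0 <= K by exact: ler0n.
exists (K * (K * c ^+ 2)); apply: filterS2 Qe hc => x Qe hc.
have N0 := lt_le_trans e0 Qe.
apply: (le_trans (cl_normM_sqr _ _)); rewrite -/K -mulrA ler_wpM2l //.
apply: (@le_trans _ _ (cl_norm (h x) ^+ 2 *
  (K * cl_norm (h x) ^+ 2 * cl_norm (Qpoly s (h x))^-1 ^+ 2))).
  by rewrite ler_wpM2l ?sqr_ge0 //; exact: cl_normM_sqr.
rewrite paravector_norm_inv; last exact: paravector_Qpoly.
rewrite exprVn -mulrA mulrCA ler_wpM2l // mulrA ler_pdivrMr ?exprn_gt0 //.
by rewrite -expr2 -(exprMn _ c) lerXn2r ?nnegrE ?sqr_ge0 // mulr_ge0 // ltW.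
Qed.

(** If (Qpoly s h) u = v, then h u and h^2 u are the products of v with h / Qpoly
    and h^2 / Qpoly; both factors are bounded, so u lies in the domain of the
    square and the inclusion of [op_Q_sub_mul] is an equality. *)
Lemma op_inv_Q :
  op_inv (op_Q s (mul_op mu h)) = mul_op mu (fun x => (Qpoly s (h x))^-1).
Proof.
rewrite -(mul_op_inv Qpoly_unit); apply/seteqP; split=> -[v u].
  exact: op_Q_sub_mul.
move=> uv.
have vu : mul_op mu (fun x => (Qpoly s (h x))^-1) (v, u).
  by rewrite -(mul_op_inv Qpoly_unit).
have mQ := cl_measurable_Qpoly_inv; have mhQ := cl_measurableM mh mQ.
have [w vw] := mul_op_total v mhQ id_Qpoly_inv_bounded.
have [y vy] := mul_op_total v (cl_measurableM mh mhQ) sqr_Qpoly_inv_bounded.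
apply: (op_Q_intro (w := w) (y := y)) uv.
- by apply: filterS2 vu vw => x /= -> ->; rewrite mulrA.
- by apply: filterS2 vw vy => x /= -> ->; rewrite !mulrA.
Qed.

Lemma resolvent_bounded : bounded_operators (op_inv (op_Q s (mul_op mu h))).
Proof.
rewrite op_inv_Q; apply: mul_op_bounded; first exact: cl_measurable_Qpoly_inv.
exact: Qpoly_inv_bounded.
Qed.

Lemma SL_resolvent_mul :
  SL_resolvent s (mul_op mu h) = mul_op mu (fun x => SL_kernel s (h x)).
Proof.
have mQ := cl_measurable_Qpoly_inv.
rewrite /SL_resolvent op_inv_Q op_lmulE.
rewrite mul_op_comp; [|exact: cl_measurable_cst|exact: ae_bounded_cst].
rewrite mul_op_comp; [|by []|exact: Qpoly_inv_bounded].
rewrite mul_op_sub //; first by apply: cl_measurableM => //; exact: cl_measurable_cst.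
by apply: ae_boundedM; [exact: Qpoly_inv_bounded|exact: ae_bounded_cst].
Qed.

Lemma SR_resolvent_mul :
  SR_resolvent s (mul_op mu h) = mul_op mu (fun x => SR_kernel s (h x)).
Proof.
rewrite /SR_resolvent op_inv_Q op_lmulE.
rewrite mul_op_sub; [|exact: cl_measurable_cst|exact: ae_bounded_cst].
by rewrite mul_op_comp; [|exact: cl_measurable_Qpoly_inv|exact: Qpoly_inv_bounded].
Qed.
End BoundedBelow.

(** If Qpoly s h were smaller than every e on a set of positive measure, choose B
    of finite positive measure in such a set and let u be its indicator. As h is
    bounded on B, u is in the domain of the square, and the L^2 norm of v = Q u is
    at most a constant times e times that of u. An inverse of norm C gives u from v,
    which forces u = 0 once e is small with respect to C. *)
Lemma bounded_below_resolvent : sigma_finite setT mu ->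
  bounded_operators (op_inv (op_Q s (mul_op mu h))) -> Q_bounded_below.
Proof.
move=> sf [F [_ _ [C FC]] FE]; apply: contrapT => nbb.
have mQ := cl_measurable_Qpoly s mh.
pose K : R := (#|{set 'I_d}| ^ 3)%:R; have K0 : 0 <= K by exact: ler0n.
(* The e below makes (C e)^2 K < 1. *)
have M0 : 0 <= C ^+ 2 * K by rewrite mulr_ge0 ?sqr_ge0.
have [e [e0 _ eC]] := exists_small_sqr M0 (@ltr01 R).
have nneg : ~ mu.-negligible [set x | cl_norm (Qpoly s (h x)) < e].
  by move=> /ae_norm_geP Qe; apply: nbb; exists e.
have [B BQ [mB Bfin nB]] := sigma_finite_subset sf
  (measurable_norm_lt mQ (ltW e0)) nneg.
pose u := L2_indic mB Bfin.
have uB : {ae mu, forall x, ~ B x -> L2_repr u x = 0}.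
  apply: filterS (L2_indicE mB Bfin) => x -> nBx.
  by rewrite /cl_indic indicE memNset // scale0r.
have QB x : B x -> cl_norm (Qpoly s (h x)) ^+ 2 <= e ^+ 2.
  by move=> /BQ /= Qe; rewrite lerXn2r ?nnegrE ?cl_norm_ge0 ?(ltW e0) ?ltW.
have hB x : B x -> cl_norm (h x) ^+ 2 <= 2 * e + 2 * cl_norm s ^+ 2.
  move=> /BQ /= Qe; apply: (le_trans (norm_sqr_le_Qpoly ps (ph x))).
  by rewrite lerD2r ler_wpM2l // ltW.
have [w uw wB] := mul_op_supported mB mh hB uB.
have [y wy _] := mul_op_supported mB mh hB wB.
have [v uv _] := mul_op_supported mB mQ QB uB.
have : op_inv (op_Q s (mul_op mu h)) (v, u) by exact: (op_Q_intro uw wy uv).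
rewrite -FE /op_graph /= => uE.
have vu : L2_norm v ^+ 2 <= (K * e ^+ 2) * L2_norm u ^+ 2.
  apply: L2_norm_sqr_le; first by rewrite mulr_ge0 ?sqr_ge0.
  apply: filterS2 uB uv => x /= uB ->; have [Bx|nBx] := pselect (B x).
    apply: (le_trans (cl_normM_sqr _ _)); rewrite ler_wpM2r ?sqr_ge0 //.
    by rewrite -/K ler_wpM2l // QB.
  by rewrite uB // mulr0 cl_norm0 expr0n mulr0.
have uv2 : L2_norm u ^+ 2 <= C ^+ 2 * L2_norm v ^+ 2.
  rewrite -exprMn lerXn2r ?nnegrE ?sqrtr_ge0 //; first last.
  - by rewrite {1}uE.
  - by apply: le_trans (FC v); exact: sqrtr_ge0.
have u0 : L2_norm u ^+ 2 = 0.
  have := sqr_ge0 (L2_norm u); have := sqr_ge0 C.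
  move: vu uv2 eC; move: (L2_norm u ^+ 2) (L2_norm v ^+ 2) => U V vu uv2 eC C0 U0.
  have le1 : U <= (C ^+ 2 * K * e ^+ 2) * U.
    apply: (le_trans uv2).
    by rewrite (_ : _ * U = C ^+ 2 * (K * e ^+ 2 * U)) ?ler_wpM2l //; ring.
  apply/eqP; rewrite eq_le U0 andbT leNgt; apply/negP => Upos.
  by move: le1; rewrite leNgt gtr_pMl // (lt_le_trans eC) ?expr1n.
have : {ae mu, forall x, ~ B x}.
  apply: filterS2 (L2_norm_sqr_eq0 u0) (L2_indicE mB Bfin) => x -> + Bx.
  rewrite /cl_indic indicE mem_set // scale1r => /esym/eqP.
  by rewrite oner_eq0.
by apply: contra_not nB; apply: negligibleS => x Bx /=; apply.
Qed.

(** If t is in [s] and in the essential range, then Qpoly s t = 0, and by continuity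
    Qpoly s h is small on the sets where h is near t. *)
Lemma hull_not_bounded_below : axial_hull (essran mu h) s -> ~ Q_bounded_below.
Proof.
move=> [_ [t [st [pt th]]]] [e e0 Qe].
have [C C0 Clip] := Qpoly_lipschitz s t.
have [r [r0 r1 Cr]] := exists_small_sqr C0 e0.
have := th r r0; rewrite lt0e => /andP[/eqP + _]; apply.
have mt : cl_measurable (fun x => h x - t).
  by apply: cl_measurableD => //; exact: cl_measurable_cst.
apply/negligibleP; first exact: measurable_norm_lt mt (ltW r0).
move/ae_norm_geP : Qe; apply: negligibleS => x /= htr.
have hr : cl_norm (h x - t) ^+ 2 <= r ^+ 2.
  by rewrite lerXn2r ?nnegrE ?cl_norm_ge0 ?(ltW r0) // ltW.
rewrite cl_norm_lt ?(ltW e0) //; apply: le_lt_trans Cr.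
have := Clip (h x); rewrite (Qpoly_sphere ps st) subr0 => hQ.
apply: (le_trans (hQ _)); last by rewrite ler_wpM2l.
by apply: (le_trans hr); rewrite expr_le1 ?(ltW r0).
Qed.

(** The sets that contain almost all values of h at the points where
    |Qpoly s h| < e, for some e > 0, form a proper filter, bounded by
    [norm_sqr_le_Qpoly]. At a cluster point t the continuous function Qpoly s
    vanishes, so t is in [s]; and no ball around t is avoided by almost all
    values of h, so t is in the essential range. *)
Lemma not_bounded_below_hull : (0 < d)%N -> ~ Q_bounded_below ->
  axial_hull (essran mu h) s.
Proof.
move=> d0 nbb; split=> //.
pose F : set_system Cl := [set B | exists2 e : R, 0 < e &
  {ae mu, forall x, cl_norm (Qpoly s (h x)) < e -> B (h x)}].
have FF : ProperFilter F.
  split.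
    move=> [e e0 Qe]; apply: nbb; exists e => //.
    by apply: filterS Qe => x Qe; rewrite leNgt; apply/negP.
  split.
  - by exists 1 => //; exact: aeW.
  - move=> B B' [e e0 eB] [e' e0' eB']; exists (Num.min e e').
      by rewrite lt_min e0.
    by apply: filterS2 eB eB' => x eB eB'; rewrite lt_min => /andP[/eB ? /eB'].
  - move=> B B' BB' [e e0 eB]; exists e => //.
    by apply: filterS eB => x eB /eB; exact: BB'.
have FM : F [set q | paravector q /\ cl_norm q <= 1 + (2 + 2 * cl_norm s ^+ 2)].
  exists 1 => //; apply: aeW => x Q1; split=> //.
  have := norm_sqr_le_Qpoly ps (ph x); have := cl_norm_ge0 (h x).
  have := sqr_ge0 (cl_norm s).
  by move: (cl_norm (h x)) (cl_norm s ^+ 2) (cl_norm _) Q1 => b a N; nra.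
have [t pt tF] := paravector_cluster FF FM.
exists t; split.
  apply: sphere_Qpoly => //; apply: cl_norm_sqr_eq0; apply/eqP.
  rewrite eq_le sqr_ge0 andbT leNgt; apply/negP => Q0.
  have [C C0 Clip] := Qpoly_lipschitz s t.
  have C1 : 0 <= 2 * (1 + C) by rewrite mulr_ge0 // addr_ge0.
  have Qt0 : 0 < cl_norm (Qpoly s t).
    by rewrite lt0r cl_norm_ge0 andbT; apply: contraTneq Q0 => ->; rewrite expr0n ltxx.
  have [r [r0 r1 Cr]] := exists_small_sqr C1 Qt0.
  have FQ : F [set q | cl_norm (Qpoly s q) < r] by exists r => //; exact: aeW.
  have [q /= Qq qt] := tF _ _ FQ r0.
  have qt2 : cl_norm (q - t) ^+ 2 <= r ^+ 2.
    by rewrite lerXn2r ?nnegrE ?cl_norm_ge0 ?(ltW r0) // ltW.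
  have Qq2 : cl_norm (Qpoly s q) ^+ 2 <= r ^+ 2.
    by rewrite lerXn2r ?nnegrE ?cl_norm_ge0 ?(ltW r0) // ltW.
  have qt1 : cl_norm (q - t) ^+ 2 <= 1.
    by apply: (le_trans qt2); rewrite expr_le1 ?(ltW r0).
  have := cl_normD_sqr (Qpoly s q) (- (Qpoly s q - Qpoly s t)).
  rewrite cl_normN opprB addrC subrK.
  have := Clip q qt1; have : C * cl_norm (q - t) ^+ 2 <= C * r ^+ 2.
    by rewrite ler_wpM2l.
  by move: Cr Qq2; lra.
split=> // e e0; rewrite lt0e measure_ge0 andbT; apply/eqP => mu0.
have FN : F [set q | ~ cl_norm (q - t) < e].
  exists 1 => //; have : mu.-negligible [set x | cl_norm (h x - t) < e].
    apply/negligibleP => //; apply: measurable_norm_lt (ltW e0).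
    by apply: cl_measurableD => //; exact: cl_measurable_cst.
  by apply: negligibleS => x /= /not_implyP[_ /contrapT].
by have [q /= + qt] := tF _ _ FN e0.
Qed.

End Resolvent.

End EssentialRangeAndResolvent.

Theorem theorem5p9 (R : realType) (disp : measure_display)
  (X : measurableType disp) (mu : {measure set X -> \bar R})
  (mu_sigma_finite : sigma_finite setT mu)
  (d : nat) (d_gt0 : (0 < d)%N)
  (h : X -> clifford R d)
  (h_measurable : cl_measurable h)
  (h_paravector : forall x, paravector (h x)) :
  S_spectrum (mul_op mu h) = axial_hull (essran mu h) /\
  (forall s : clifford R d, S_resolvent_set (mul_op mu h) s ->
     SL_resolvent s (mul_op mu h) = mul_op mu (fun x => SL_kernel s (h x)) /\
     SR_resolvent s (mul_op mu h) = mul_op mu (fun x => SR_kernel s (h x))).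
Proof.
split=> [|s [ps rs]]; last first.
  have bb := bounded_below_resolvent h_measurable h_paravector ps mu_sigma_finite rs.
  by split; [exact: SL_resolvent_mul|exact: SR_resolvent_mul].
apply/seteqP; split=> s.
  move=> [ps nrs]; apply: not_bounded_below_hull => // bb; apply: nrs; split=> //.
  exact: resolvent_bounded.
move=> hs; have ps := hs.1; split=> // -[_ rs].
apply: (hull_not_bounded_below h_measurable ps hs).
exact: bounded_below_resolvent.
Qed.
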